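(* Let $\tau>0$ and let $$\mathcal A=\begin{pmatrix}\frac{2}{\tau}M_B & M_BK & 0\\ -K^TM_B & \frac{2}{\tau}M_E+Z & M_EG\\ 0&-G^TM_E&\frac{2}{\tau}M_p\end{pmatrix},\qquad \mathcal W_{\mathcal L}=\begin{pmatrix}\frac{2}{\tau}M_B&0&0\\-K^TM_B&Q_E^{-1}&0\\0&-G^TM_E&Q_p^{-1}\end{pmatrix}^{-1},$$ where $Q_E$, $Q_p$ are symmetric positive definite. Let $$A_B=\tfrac{2}{\tau}M_B+D^TM_0D,\quad A_E=\tfrac{\tau}{2}K^TM_BK+\tfrac{2}{\tau}M_E+Z,\quad A_p=\tfrac{\tau}{2}G^TM_EG+\tfrac{2}{\tau}M_p,$$ and $\mathcal W=\mathrm{diag}(A_B^{-1},Q_E,Q_p)$, with the inner product $\langle x,y\rangle_{\mathcal W^{-1}}=\langle\mathcal W^{-1}x,y\rangle$ and norm $\|x\|_{\mathcal W^{-1}}=\langle x,x\rangle_{\mathcal W^{-1}}^{1/2}$. Assume that for positive constants $c_{1,E},c_{2,E},c_{1,p},c_{2,p}$ (independent of $h$, $\tau$, $\varepsilon$, $\mu^{-1}$) $$c_{1,E}\langle Q_EE,E\rangle\le\langle A_E^{-1}E,E\rangle\le c_{2,E}\langle Q_EE,E\rangle,\qquad c_{1,p}\langle Q_pp,p\rangle\le\langle A_p^{-1}p,p\rangle\le c_{2,p}\langle Q_pp,p\rangle$$ for all vectors $E$, $p$. Then, provided $\|I-Q_EA_E\|_{A_E}\le\rho<\sqrt3-1$,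 there exist positive constants $\lambda$ and $\Lambda$ such that for every $x\neq0$ $$\lambda\le\frac{\langle\mathcal W_{\mathcal L}\mathcal A x,x\rangle_{\mathcal W^{-1}}}{\langle x,x\rangle_{\mathcal W^{-1}}},\qquad \frac{\|\mathcal W_{\mathcal L}\mathcal A x\|_{\mathcal W^{-1}}}{\|x\|_{\mathcal W^{-1}}}\le\Lambda .$$ The constants $\lambda,\Lambda$ (which may depend on $c_{1,E},c_{2,E},c_{1,p},c_{2,p},\rho$) depend neither on the discretization parameters $h$ and $\tau$ nor on the physical parameters $\varepsilon$ and $\mu^{-1}$.
   Context: Setting. $\Omega=\mathcal S\setminus\overline{\mathcal O}\subset\mathbb R^3$ is a bounded Lipschitz domain (polyhedral, meshed by tetrahedra of mesh size $h$), $\mathcal O$ an obstacle inside a large ball $\mathcal S$; $\Gamma_i=\partial\Omega\cap\partial\mathcal O$, $\Gamma_o=\partial\Omega\setminus\Gamma_i$. $\varepsilon,\mu$ are positive continuous functions on $\overline\Omega$; $\gamma$ is a constant with $1+\gamma\ge0$. $H_{h,0}(\mathrm{grad})\subset H_0^1(\Omega)$, $H_{h,\mathrm{imp}}(\mathrm{curl})\subset\{v\in H(\mathrm{curl}):v\wedge n|_{\Gamma_o}=0\}$, $H_{h,\mathrm{imp}}(\mathrm{div})\subset\{v\in H(\mathrm{div}):v\cdot n|_{\Gamma_o}=0\}$ are the Lagrange, Nédélec and Raviart–Thomas finite element spaces of matching order, and $L_h^2$ the matching piecewise polynomial space, so that grad, curl, div map each space into the next. Matrices. $M_p$, $M_E$,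 $M_B$, $M_0$ are the mass matrices of $H_{h,0}(\mathrm{grad})$ (unweighted $L^2$), $H_{h,\mathrm{imp}}(\mathrm{curl})$ ($\varepsilon$-weighted $L^2$), $H_{h,\mathrm{imp}}(\mathrm{div})$ ($\mu^{-1}$-weighted $L^2$) and $L_h^2$ (unweighted); all are symmetric positive definite. $Z$ is the symmetric positive semidefinite matrix of the form $(1+\gamma)\int_{\Gamma_i}E_{\mathrm{tan}}\cdot F_{\mathrm{tan}}$ on $H_{h,\mathrm{imp}}(\mathrm{curl})$, where $F_{\mathrm{tan}}=F-(F\cdot n)n$. $G$, $K$, $D$ are the matrices of grad, curl, div between consecutive spaces in terms of the finite element bases and degrees of freedom; they satisfy $KG=0$, $DK=0$, $G^TZ=0$. Vectors are split as $x=(B,E,p)^T$ according to the three spaces; $\langle\cdot,\cdot\rangle$ between vectors is the Euclidean pairing, and $\|\cdot\|_{A_E}$ is the operator norm induced by the inner product $\langle A_E\cdot,\cdot\rangle$. *)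

(* Defs.v *)
From HB Require Import structures.
From mathcomp Require Import all_boot all_order all_algebra.
(* The notations of mpoly clash with those of mathcomp-analysis. *)
From mathcomp Require Import -(notations) mpoly.
From mathcomp Require Import all_classical all_reals all_analysis.

Set Implicit Arguments.
Unset Strict Implicit.
Unset Printing Implicit Defensive.

Import Order.TTheory GRing.Theory Num.Theory.
Import numFieldNormedType.Exports.

Local Open Scope classical_set_scope.
Local Open Scope ring_scope.

Section Geometry.
Variable R : realType.
Implicit Types (x y : 'rV[R]_3) (A D S O : set 'rV[R]_3).

Definition boundary A : set 'rV[R]_3 := closure A `\` interior A.

Definition cross (K : comNzRingType) (u v : 'I_3 -> K) (i : 'I_3) : K :=
  u (ordS i) * v (ordS (ordS i)) - u (ordS (ordS i)) * v (ordS i).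

Definition crossv x y : 'rV[R]_3 := \row_i cross (x 0) (y 0) i.

Definition dotv x y : R := \sum_i x 0 i * y 0 i.

(* The library norm on 'rV[R]_3 is the sup norm. *)
Definition enorm x : R := Num.sqrt (dotv x x).

(* Near each boundary point, and in suitable orthonormal coordinates, D is the
   strict epigraph of a Lipschitz function of two variables. *)
Definition lipschitz_domain D : Prop :=
  [/\ open D, bounded_set D, connected D, D !=set0 &
    forall x, boundary D x ->
      exists (U : 'M[R]_3) (f : 'rV[R]_2 -> R),
        [/\ U *m U^T = 1%:M, lipschitz f &
            \forall y \near x,
              D y <-> f (\row_j (y *m U) 0 (lift ord_max j))
                        < (y *m U) 0 ord_max]].

Definition exterior_region S O := S `\` closure O.

(* S is only assumed bounded and open: for S `\` closure O to be meshed exactly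
   by tetrahedra, the ball S has to be replaced by a polyhedron. *)
Record scattering_setting S O : Prop := ScatteringSetting {
  sc_openS : open S;
  sc_bndS : bounded_set S;
  sc_openO : open O;
  sc_inside : closure O `<=` S;
  sc_lipschitz : lipschitz_domain (exterior_region S O) }.

Definition Gamma_i S O := boundary (exterior_region S O) `&` boundary O.
Definition Gamma_o S O := boundary (exterior_region S O) `\` Gamma_i S O.

Definition positive_continuous_on A (w : 'rV[R]_3 -> R) : Prop :=
  {within A, continuous w} /\ forall x, A x -> 0 < w x.

Definition hull (a : 'I_4 -> 'rV[R]_3) (P : pred 'I_4) : set 'rV[R]_3 :=
  [set x | exists w : 'I_4 -> R,
     [/\ forall i, 0 <= w i, forall i, ~~ P i -> w i = 0,
         \sum_i w i = 1 & x = \sum_i w i *: a i]].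

(* Conforming tetrahedral meshes of an open set D. *)
Record mesh D := Mesh {
  ntet : nat;
  vtx : 'I_ntet -> 'I_4 -> 'rV[R]_3;
  mesh_nondegenerate : forall T,
    \det (\matrix_(i < 3, j < 3) (vtx T (lift ord0 i) - vtx T ord0) 0 j) != 0;
  mesh_covers : closure D = \bigcup_T hull (vtx T) predT;
  mesh_disjoint : forall T T', T != T' ->
    interior (hull (vtx T) predT) `&` interior (hull (vtx T') predT) = set0;
  mesh_conforming : forall T T', T != T' ->
    hull (vtx T) predT `&` hull (vtx T') predT
    = hull (vtx T) (fun i => [exists j, vtx T i == vtx T' j]) }.

End Geometry.

Section FiniteElements.
Variable R : realType.
Local Notation pol := (mpoly 3 R).
Local Notation vpol := {ffun 'I_3 -> mpoly 3 R}.
Variables (S O : set 'rV[R]_3) (Th : mesh (exterior_region S O)).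
Local Notation N := (ntet Th).
Implicit Types (T : 'I_(ntet Th)) (x : 'rV[R]_3) (k n : nat).

Definition tet T : set 'rV[R]_3 := hull (vtx T) predT.

(* The face of T opposite to its i-th vertex. *)
Definition face T (i : 'I_4) : set 'rV[R]_3 := hull (vtx T) (predC1 i).

Definition fvtx T (i : 'I_4) (j : 'I_3) : 'rV[R]_3 := vtx T (lift i j).

Definition edge1 T i : 'rV[R]_3 := fvtx T i (inord 1) - fvtx T i ord0.
Definition edge2 T i : 'rV[R]_3 := fvtx T i (inord 2) - fvtx T i ord0.

(* The orientation of the unit normal is irrelevant to all its uses below. *)
Definition normal T i : 'rV[R]_3 :=
  (enorm (crossv (edge1 T i) (edge2 T i)))^-1
    *: crossv (edge1 T i) (edge2 T i).

Definition ev x (p : pol) : R := meval (fun i => x 0 i) p.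
Definition vev x (v : vpol) : 'rV[R]_3 := \row_i ev x (v i).

Definition degree_le k (p : pol) : Prop := (msize p <= k.+1)%N.

(* A piecewise polynomial field is the family of its restrictions to the
   tetrahedra, each of them a formal polynomial; as the tetrahedra are
   nondegenerate, this polynomial is determined by its values. *)
Definition pw_scalar := {ffun 'I_N -> pol}.
Definition pw_vector := {ffun 'I_N -> vpol}.

Definition grad (p : pw_scalar) : pw_vector :=
  [ffun T => [ffun i => mderiv i (p T)]].

Definition curl (v : pw_vector) : pw_vector :=
  [ffun T => [ffun i => mderiv (ordS i) (v T (ordS (ordS i)))
                        - mderiv (ordS (ordS i)) (v T (ordS i))]].

Definition div (v : pw_vector) : pw_scalar :=
  [ffun T => \sum_i mderiv i (v T i)].

Definition Xvec (i : 'I_3) : pol := mpolyX R (mnm1 i).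

(* The four spaces have matching order k >= 0: Lagrange elements of degree
   k + 1, Nedelec elements of the first kind with local space
   P_k^3 + x cross P_k^3 and Raviart-Thomas elements with local space
   P_k^3 + x P_k (in the second summands the homogeneous polynomials of degree
   k alone would give the same spaces), and discontinuous P_k elements.
   Conformity is the continuity of values, of tangential components and of
   normal components across interelement faces. *)
Definition lagrange0 k : set pw_scalar := [set p |
  [/\ forall T, degree_le k.+1 (p T),
      forall T T' x, tet T x -> tet T' x -> ev x (p T) = ev x (p T') &
      forall T x, tet T x -> boundary (exterior_region S O) x ->
        ev x (p T) = 0]].

Definition nedelec_local k (v : vpol) : Prop :=
  exists a b : vpol, [/\ forall i, degree_le k (a i),
    forall i, degree_le k (b i) & forall i, v i = a i + cross Xvec b i].

Definition nedelec_imp k : set pw_vector := [set v |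
  [/\ forall T, nedelec_local k (v T),
      forall T T' i i' x, face T i = face T' i' -> face T i x ->
        crossv (vev x (v T)) (normal T i) = crossv (vev x (v T')) (normal T i) &
      forall T i x, face T i `<=` Gamma_o S O -> face T i x ->
        crossv (vev x (v T)) (normal T i) = 0]].

Definition rt_local k (v : vpol) : Prop :=
  exists (a : vpol) (b : pol), [/\ forall i, degree_le k (a i),
    degree_le k b & forall i, v i = a i + Xvec i * b].

Definition rt_imp k : set pw_vector := [set v |
  [/\ forall T, rt_local k (v T),
      forall T T' i i' x, face T i = face T' i' -> face T i x ->
        dotv (vev x (v T)) (normal T i) = dotv (vev x (v T')) (normal T i) &
      forall T i x, face T i `<=` Gamma_o S O -> face T i x ->
        dotv (vev x (v T)) (normal T i) = 0]].

Definition dg k : set pw_scalar := [set q | forall T, degree_le k (q T)].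

Definition is_basis (V : lmodType R) (H : set V) n (phi : 'I_n -> V) : Prop :=
  (forall c : 'I_n -> R, \sum_i c i *: phi i = 0 -> forall i, c i = 0) /\
  H = [set v | exists c : 'I_n -> R, v = \sum_i c i *: phi i].

(* M is the matrix of L with respect to the families phi and psi. *)
Definition matrix_of (V W : lmodType R) (L : V -> W) m n
    (phi : 'I_n -> V) (psi : 'I_m -> W) (M : 'M[R]_(m, n)) : Prop :=
  forall j, L (phi j) = \sum_i M i j *: psi i.

Definition pt3 (u : R * R * R) : 'rV[R]_3 :=
  \row_(i < 3) [:: u.1.1; u.1.2; u.2]`_i.

Definition vol_integral (A : set 'rV[R]_3) (f : 'rV[R]_3 -> R) : R :=
  (\int[((lebesgue_measure \x lebesgue_measure) \x lebesgue_measure)%E]_(u in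
     [set u : measurableTypeR R * measurableTypeR R * measurableTypeR R
        | A (pt3 u)]) f (pt3 u))%R.

(* Surface integral over the face of T opposite to its i-th vertex, through its
   affine parametrization by the reference triangle. *)
Definition face_integral T i (f : 'rV[R]_3 -> R) : R :=
  enorm (crossv (edge1 T i) (edge2 T i)) *
  (\int[(lebesgue_measure \x lebesgue_measure)%E]_(u in
     [set u : measurableTypeR R * measurableTypeR R
        | [/\ 0 <= (u.1 : R), 0 <= (u.2 : R) & (u.1 : R) + u.2 <= 1]])
     f (fvtx T i ord0 + (u.1 : R) *: edge1 T i + (u.2 : R) *: edge2 T i))%R.

Definition mass_scalar (w : 'rV[R]_3 -> R) n (phi : 'I_n -> pw_scalar) :
    'M[R]_n :=
  \matrix_(i, j) \sum_T
    vol_integral (tet T) (fun x => w x * (ev x (phi i T) * ev x (phi j T))).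

Definition mass_vector (w : 'rV[R]_3 -> R) n (phi : 'I_n -> pw_vector) :
    'M[R]_n :=
  \matrix_(i, j) \sum_T
    vol_integral (tet T)
      (fun x => w x * dotv (vev x (phi i T)) (vev x (phi j T))).

Definition tang (nu F : 'rV[R]_3) : 'rV[R]_3 := F - dotv F nu *: nu.

Definition impedance (gamma : R) n (phi : 'I_n -> pw_vector) : 'M[R]_n :=
  \matrix_(i, j) ((1 + gamma) *
    \sum_(F : 'I_N * 'I_4 | `[< face F.1 F.2 `<=` Gamma_i S O >])
      face_integral F.1 F.2 (fun x =>
        dotv (tang (normal F.1 F.2) (vev x (phi i F.1)))
             (tang (normal F.1 F.2) (vev x (phi j F.1))))).

End FiniteElements.

Section InnerProducts.
Variable R : realType.

Definition ip n (M : 'M[R]_n) (x y : 'cV[R]_n) : R := ((M *m x)^T *m y) 0 0.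

Definition ipnorm n (M : 'M[R]_n) (x : 'cV[R]_n) : R := Num.sqrt (ip M x x).

Definition spd n (M : 'M[R]_n) : Prop :=
  M^T = M /\ forall x : 'cV[R]_n, x != 0 -> 0 < ip M x x.

(* Operator norm of T for the norm of the inner product ip M. *)
Definition opnorm n (M T : 'M[R]_n) : \bar R :=
  ereal_sup [set (ipnorm M (T *m x))%:E | x in
               [set x : 'cV[R]_n | ipnorm M x <= 1]].

End InnerProducts.

Section Systems.
Variables (R : realType) (nB nE np n0 : nat).
Variables (tau : R).
Variables (MB : 'M[R]_nB) (ME : 'M[R]_nE) (Mp : 'M[R]_np) (M0 : 'M[R]_n0).
Variables (Z : 'M[R]_nE).
Variables (G : 'M[R]_(nE, np)) (K : 'M[R]_(nB, nE)) (D : 'M[R]_(n0, nB)).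
Variables (QE : 'M[R]_nE) (Qp : 'M[R]_np).

(* Unknowns are ordered as col_mx B (col_mx E p). *)
Definition sysA : 'M[R]_(nB + (nE + np)) :=
  block_mx
    ((2 / tau) *: MB)        (row_mx (MB *m K) 0)
    (col_mx (- K^T *m MB) 0) (block_mx ((2 / tau) *: ME + Z) (ME *m G)
                                       (- G^T *m ME) ((2 / tau) *: Mp)).

Definition precWL : 'M[R]_(nB + (nE + np)) :=
  invmx (block_mx
    ((2 / tau) *: MB)        (row_mx 0 0)
    (col_mx (- K^T *m MB) 0) (block_mx (invmx QE) 0
                                       (- G^T *m ME) (invmx Qp))).

Definition schurB : 'M[R]_nB := (2 / tau) *: MB + D^T *m M0 *m D.
Definition schurE : 'M[R]_nE :=
  (tau / 2) *: (K^T *m MB *m K) + (2 / tau) *: ME + Z.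
Definition schurp : 'M[R]_np :=
  (tau / 2) *: (G^T *m ME *m G) + (2 / tau) *: Mp.

Definition precW : 'M[R]_(nB + (nE + np)) :=
  block_mx (invmx schurB) (row_mx 0 0)
           (col_mx 0 0)   (block_mx QE 0 0 Qp).

End Systems.

(* Main.v *)
(** With g = (tau/2) G p, u = E + g and T = I - Q_E A_E, the relations K G = 0, Z G = 0
    give A_E G = (2/tau) M_E G, and block forward substitution shows that
    W_L A (B, E, p) = (B + (tau/2) K E, u - T u, Q_p (A_p p - (tau/2) G^T A_E T u)).
    Let b, r, q be the norms of B, u, p for A_B, A_E, A_p.  Since K E = K u, D K = 0 and
    the A_E-norm of g is at most q, pairing with (B, E, p) in W^-1 yields at least
    b^2 - b r + r^2 - (1 + rho) r q + q^2, a quadratic form which is positive definite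
    exactly when (1 + rho)^2 < 3.  The norms of E and p for Q_E^-1, Q_p^-1 and for
    A_E, A_p are equivalent by duality, with constants c_{i,E}, c_{i,p}.

    The properties of the matrices come from the finite element spaces: K G = 0 and
    D K = 0 hold for formal polynomials; the mass matrices are Gram matrices, definite
    because a nonzero polynomial does not vanish on an open ball; and Z G = 0 because a
    polynomial that vanishes on a face vanishes on its plane, so that its gradient there
    is normal to the face. *)
Require Import Defs.
From mathcomp Require Import all_boot all_order all_algebra.
From mathcomp Require Import -(notations) mpoly.
From mathcomp Require Import all_classical all_reals all_analysis.
From mathcomp Require Import measurable_realfun ring lra.

Import Order.TTheory GRing.Theory Num.Theory.
Import numFieldNormedType.Exports.

Local Open Scope classical_set_scope.
Local Open Scope ring_scope.

(** * Inner products of symmetric matrices *)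

Section EuclideanPairing.
Set Implicit Arguments.
Unset Strict Implicit.
Unset Printing Implicit Defensive.
Context {R : realType}.
Implicit Types m n : nat.

Definition dot n (x y : 'cV[R]_n) : R := (x^T *m y) 0 0.
Definition psd n (M : 'M[R]_n) := M^T = M /\ forall x, 0 <= ip M x x.

Lemma ip_dot n (M : 'M[R]_n) x y : ip M x y = dot (M *m x) y.
Proof. by []. Qed.

Lemma dotC n (x y : 'cV[R]_n) : dot x y = dot y x.
Proof. by rewrite /dot !mxE; apply: eq_bigr => i _; rewrite !mxE mulrC. Qed.

Lemma dotDl n (x y z : 'cV[R]_n) : dot (x + y) z = dot x z + dot y z.
Proof. by rewrite /dot linearD mulmxDl mxE. Qed.

Lemma dotNl n (x y : 'cV[R]_n) : dot (- x) y = - dot x y.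
Proof. by rewrite /dot linearN mulNmx mxE. Qed.

Lemma dotZl n a (x y : 'cV[R]_n) : dot (a *: x) y = a * dot x y.
Proof. by rewrite /dot linearZ -scalemxAl mxE. Qed.

Lemma dotDr n (x y z : 'cV[R]_n) : dot z (x + y) = dot z x + dot z y.
Proof. by rewrite !(dotC z) dotDl. Qed.

Lemma dotNr n (x y : 'cV[R]_n) : dot y (- x) = - dot y x.
Proof. by rewrite !(dotC y) dotNl. Qed.

Lemma dotZr n a (x y : 'cV[R]_n) : dot y (a *: x) = a * dot y x.
Proof. by rewrite !(dotC y) dotZl. Qed.

Lemma dot0l n (x : 'cV[R]_n) : dot 0 x = 0.
Proof. by rewrite /dot linear0 mul0mx mxE. Qed.

Lemma dot_adj m n (A : 'M[R]_(m, n)) x y : dot (A *m x) y = dot x (A^T *m y).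
Proof. by rewrite /dot trmx_mul mulmxA. Qed.

Lemma dot_col m n (x1 y1 : 'cV[R]_m) (x2 y2 : 'cV[R]_n) :
  dot (col_mx x1 x2) (col_mx y1 y2) = dot x1 y1 + dot x2 y2.
Proof. by rewrite /dot tr_col_mx mul_row_col mxE. Qed.

Lemma ipC n (M : 'M[R]_n) x y : M^T = M -> ip M x y = ip M y x.
Proof. by move=> sM; rewrite !ip_dot dot_adj sM dotC. Qed.

Lemma ipDl n (M : 'M[R]_n) x y z : ip M (x + y) z = ip M x z + ip M y z.
Proof. by rewrite !ip_dot mulmxDr dotDl. Qed.

Lemma ipDr n (M : 'M[R]_n) x y z : ip M z (x + y) = ip M z x + ip M z y.
Proof. by rewrite !ip_dot dotDr. Qed.

Lemma ipNl n (M : 'M[R]_n) x y : ip M (- x) y = - ip M x y.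
Proof. by rewrite !ip_dot mulmxN dotNl. Qed.

Lemma ipNr n (M : 'M[R]_n) x y : ip M x (- y) = - ip M x y.
Proof. by rewrite !ip_dot dotNr. Qed.

Lemma ipZl n (M : 'M[R]_n) a x y : ip M (a *: x) y = a * ip M x y.
Proof. by rewrite !ip_dot -scalemxAr dotZl. Qed.

Lemma ipZr n (M : 'M[R]_n) a x y : ip M x (a *: y) = a * ip M x y.
Proof. by rewrite !ip_dot dotZr. Qed.

Lemma ip0l n (M : 'M[R]_n) x : ip M 0 x = 0.
Proof. by rewrite ip_dot mulmx0 dot0l. Qed.

Lemma ip_addmx n (M N : 'M[R]_n) x y : ip (M + N) x y = ip M x y + ip N x y.
Proof. by rewrite !ip_dot mulmxDl dotDl. Qed.

Lemma ip_scalemx n a (M : 'M[R]_n) x y : ip (a *: M) x y = a * ip M x y.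
Proof. by rewrite !ip_dot -scalemxAl dotZl. Qed.

Lemma ip_congr m n (M : 'M[R]_m) (A : 'M[R]_(m, n)) x y :
  ip (A^T *m M *m A) x y = ip M (A *m x) (A *m y).
Proof. by rewrite !ip_dot -!mulmxA dot_adj trmxK. Qed.

Lemma spd_psd n (M : 'M[R]_n) : spd M -> psd M.
Proof.
case=> sM pM; split=> // x; have [->|x0] := eqVneq x 0; first by rewrite ip0l.
exact/ltW/pM.
Qed.

Lemma psd_congr m n (M : 'M[R]_m) (A : 'M[R]_(m, n)) :
  psd M -> psd (A^T *m M *m A).
Proof.
by case=> sM pM; split=> [|x]; rewrite ?ip_congr // !trmx_mul trmxK sM mulmxA.
Qed.

Lemma psd_add n (M N : 'M[R]_n) : psd M -> psd N -> psd (M + N).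
Proof.
move=> [sM pM] [sN pN]; split=> [|x]; first by rewrite linearD /= sM sN.
by rewrite ip_addmx addr_ge0.
Qed.

Lemma psd_scale n a (M : 'M[R]_n) : 0 <= a -> psd M -> psd (a *: M).
Proof.
move=> a0 [sM pM]; split=> [|x]; first by rewrite linearZ /= sM.
by rewrite ip_scalemx mulr_ge0.
Qed.

Lemma spd_scale n a (M : 'M[R]_n) : 0 < a -> spd M -> spd (a *: M).
Proof.
move=> a0 [sM pM]; split=> [|x x0]; first by rewrite linearZ /= sM.
by rewrite ip_scalemx mulr_gt0 // pM.
Qed.

Lemma spd_addl n (M N : 'M[R]_n) : spd M -> psd N -> spd (M + N).
Proof.
move=> [sM pM] [sN pN]; split=> [|x x0]; first by rewrite linearD /= sM sN.
by rewrite ip_addmx ltr_wpDr // pM.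
Qed.

(** A row vector in the left kernel has, by symmetry, zero energy, which definiteness excludes. *)
Lemma spd_unit n (M : 'M[R]_n) : spd M -> M \in unitmx.
Proof.
case=> sM pM; rewrite unitmxE unitfE; apply/det0P => -[v v0 vM].
have := pM v^T; rewrite -(inj_eq trmx_inj) trmxK trmx0 => /(_ v0).
by rewrite /ip trmx_mul trmxK sM vM mul0mx mxE ltxx.
Qed.

Lemma spd_inv n (M : 'M[R]_n) : spd M -> spd (invmx M).
Proof.
move=> hM; have uM := spd_unit hM; case: (hM) => sM pM.
split=> [|x x0]; first by rewrite trmx_inv sM.
have: invmx M *m x != 0.
  by apply: contraNneq x0 => /(congr1 (mulmx M)); rewrite mulKVmx // mulmx0 => ->.
by move=> /pM; rewrite !ip_dot mulKVmx // dotC.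
Qed.

Lemma ip_invmx n (M : 'M[R]_n) x : spd M ->
  ip (invmx M) x x = ip M (invmx M *m x) (invmx M *m x).
Proof. by move=> hM; rewrite !ip_dot mulKVmx ?spd_unit // dotC. Qed.

Lemma ip_eq0 n (M : 'M[R]_n) x : spd M -> ip M x x = 0 -> x = 0.
Proof.
by case=> _ pM /eqP xx; apply: contraTeq xx => /pM; rewrite lt0r => /andP[].
Qed.

(** The square of [x + t *: y] is a quadratic in t without negative values. As [M] is only
    semidefinite, [ip M y y] may vanish for a nonzero y, so this case is treated apart. *)
Lemma ip_CauchySchwarz n (M : 'M[R]_n) x y : psd M ->
  ip M x y ^+ 2 <= ip M x x * ip M y y.
Proof.
move=> [sM pM].
have key t : 0 <= ip M x x + t * ip M x y *+ 2 + t ^+ 2 * ip M y y.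
  have := pM (x + t *: y).
  rewrite !ipDl !ipDr !ipZl !ipZr (ipC y x sM); congr (_ <= _); ring.
have := pM y; rewrite le_eqVlt => /orP[/eqP y0|y0].
  move: key; rewrite -y0 mulr0 => key.
  have [->|b0] := eqVneq (ip M x y) 0; first by rewrite expr0n.
  (* The quadratic has become affine in t, and at this t it would take the value -1. *)
  have := key (- (ip M x x + 1) / (2 * ip M x y)).
  have -> : - (ip M x x + 1) / (2 * ip M x y) * ip M x y *+ 2 = - (ip M x x + 1).
    by field.
  by rewrite mulr0 addr0 opprD addrA subrr add0r oppr_ge0 ler10.
(* Here t is the minimiser of the quadratic. *)
have := key (- ip M x y / ip M y y); move: (ip M y y) (ip M x y) (ip M x x) y0.
move=> c b a c0 h; rewrite -subr_ge0.
have -> : a * c - b ^+ 2 = c * (a + - b / c * b *+ 2 + (- b / c) ^+ 2 * c).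
  by field; rewrite gt_eqF.
by rewrite mulr_ge0 // ltW.
Qed.

Lemma ipnorm_ge0 n (M : 'M[R]_n) x : 0 <= ipnorm M x.
Proof. exact: sqrtr_ge0. Qed.

Lemma sqr_ipnorm n (M : 'M[R]_n) x : psd M -> ipnorm M x ^+ 2 = ip M x x.
Proof. by case=> _ pM; rewrite sqr_sqrtr. Qed.

Lemma ler_ipnorm n (M : 'M[R]_n) x y : psd M ->
  `|ip M x y| <= ipnorm M x * ipnorm M y.
Proof.
move=> hM; rewrite -ler_sqr ?nnegrE ?mulr_ge0 ?ipnorm_ge0 //.
by rewrite exprMn !sqr_ipnorm // real_normK ?num_real // ip_CauchySchwarz.
Qed.

Lemma ipnormD n (M : 'M[R]_n) x y : psd M ->
  ipnorm M (x + y) <= ipnorm M x + ipnorm M y.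
Proof.
move=> hM; rewrite -ler_sqr ?nnegrE ?addr_ge0 ?ipnorm_ge0 // sqrrD.
rewrite !sqr_ipnorm // ipDl !ipDr (ipC y x hM.1).
have := le_trans (ler_norm _) (ler_ipnorm x y hM).
move: (ip M x y) (ipnorm M x * _) (ip M x x) (ip M y y) => a b c d; lra.
Qed.

Lemma ipnormZ n (M : 'M[R]_n) a x : 0 <= a -> ipnorm M (a *: x) = a * ipnorm M x.
Proof.
by move=> a0; rewrite /ipnorm ipZl ipZr mulrA -expr2 sqrtrM ?sqr_ge0 // sqrtr_sqr
  ger0_norm.
Qed.

Lemma ipnormN n (M : 'M[R]_n) x : ipnorm M (- x) = ipnorm M x.
Proof. by rewrite /ipnorm ipNl ipNr opprK. Qed.

Lemma ipnorm0_eq0 n (M : 'M[R]_n) x : spd M -> ipnorm M x = 0 -> x = 0.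
Proof.
move=> [sM pM] /eqP; rewrite sqrtr_eq0 leNgt; apply: contraNeq; exact: pM.
Qed.

(** The supremum over the unit ball is tested at x divided by its norm, which is positive because
    [M] is definite. *)
Lemma opnorm_le n (M T : 'M[R]_n) rho x : spd M -> (opnorm M T <= rho%:E)%E ->
  ipnorm M (T *m x) <= rho * ipnorm M x.
Proof.
move=> hM hT; have [->|x0] := eqVneq x 0.
  by rewrite mulmx0 /ipnorm ip0l sqrtr0 mulr0.
have nx : 0 < ipnorm M x by rewrite lt_def ipnorm_ge0 andbT; apply: contra_neq x0;
  exact: ipnorm0_eq0.
have : ((ipnorm M (T *m ((ipnorm M x)^-1 *: x)))%:E <= rho%:E)%E.
  apply: le_trans hT; apply: ereal_sup_ubound; exists ((ipnorm M x)^-1 *: x) => //=.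
  by rewrite ipnormZ ?invr_ge0 ?ipnorm_ge0 // mulVf // gt_eqF.
rewrite lee_fin -scalemxAr ipnormZ ?invr_ge0 ?ipnorm_ge0 //.
by rewrite mulrC ler_pdivrMr.
Qed.

Lemma opnorm_ge0 n (M T : 'M[R]_n) : (0 <= opnorm M T)%E.
Proof.
apply: ereal_sup_ubound; exists 0 => /=.
  by rewrite /ipnorm ip0l sqrtr0.
by rewrite mulmx0 /ipnorm ip0l sqrtr0.
Qed.

Lemma dot_CauchySchwarz_inv n (M : 'M[R]_n) x w : spd M ->
  dot x w ^+ 2 <= ip M x x * ip (invmx M) w w.
Proof.
move=> hM; have uM := spd_unit hM; have psM := spd_psd hM.
have := ip_CauchySchwarz x (invmx M *m w) psM.
rewrite -ip_invmx // ip_dot dot_adj psM.1 mulKVmx //.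
Qed.

(** Duality: for w = Q^-1 v the Cauchy-Schwarz inequality bounds the square of [ip (invmx Q) v v] by
    [ip P v v * ip (invmx P) w w]. The hypothesis replaces the last factor by
    [c * ip (invmx Q) v v], and one factor [ip (invmx Q) v v] cancels. *)
Lemma ip_invmx_le n (P Q : 'M[R]_n) c : spd P -> spd Q -> 0 < c ->
  (forall v, ip (invmx P) v v <= c * ip Q v v) ->
  forall v, ip (invmx Q) v v <= c * ip P v v.
Proof.
move=> hP hQ c0 h v; have uQ := spd_unit hQ; have psQ := spd_psd (spd_inv hQ).
have [v0|v0] := eqVneq (ip (invmx Q) v v) 0.
  by rewrite v0 mulr_ge0 ?(ltW c0) //; case: (spd_psd hP).
have q0 : 0 < ip (invmx Q) v v by rewrite lt_def v0; case: psQ => _ ->.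
have := dot_CauchySchwarz_inv v (invmx Q *m v) hP.
rewrite dotC -ip_dot => /le_trans/(_ (ler_wpM2l ((spd_psd hP).2 v) (h _))).
rewrite -ip_invmx // expr2 mulrA ler_pM2r //.
by rewrite mulrC.
Qed.

(** Turns a comparison of Q with P^-1, the form of the assumptions on the preconditioners, into one
    of Q^-1 with P, the form needed for the weight W^-1. The lower bound is the upper one for the
    inverse matrices with constant 1/c1. *)
Lemma ip_invmx_bounds n (P Q : 'M[R]_n) c1 c2 : spd P -> spd Q -> 0 < c1 -> 0 < c2 ->
  (forall v, c1 * ip Q v v <= ip (invmx P) v v <= c2 * ip Q v v) ->
  forall v, c1 * ip P v v <= ip (invmx Q) v v <= c2 * ip P v v.
Proof.
move=> hP hQ c10 c20 h v; apply/andP; split; last first.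
  by apply: ip_invmx_le => // w; case/andP: (h w).
have := @ip_invmx_le _ _ _ c1^-1 (spd_inv hQ) (spd_inv hP) _ _ v.
rewrite !invmxK mulrC ler_pdivlMr // mulrC; apply; first by rewrite invr_gt0.
by move=> w; rewrite mulrC ler_pdivlMr // mulrC; case/andP: (h w).
Qed.

End EuclideanPairing.

(** * The preconditioned system *)

Section PreconditionedSystem.
Set Implicit Arguments.
Unset Strict Implicit.
Unset Printing Implicit Defensive.
Context {R : realType} (nB nE np n0 : nat) (tau : R).
Context (MB : 'M[R]_nB) (ME : 'M[R]_nE) (Mp : 'M[R]_np) (M0 : 'M[R]_n0).
Context (Z : 'M[R]_nE).
Context (G : 'M[R]_(nE, np)) (K : 'M[R]_(nB, nE)) (D : 'M[R]_(n0, nB)).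
Context (QE : 'M[R]_nE) (Qp : 'M[R]_np).
Hypotheses (tau0 : 0 < tau) (hMB : spd MB) (hME : spd ME) (hMp : spd Mp).
Hypotheses (hM0 : psd M0) (hZ : psd Z) (KG : K *m G = 0) (DK : D *m K = 0).
Hypotheses (ZG : Z *m G = 0) (hQE : spd QE) (hQp : spd Qp).

Local Notation AB := (schurB tau MB M0 D).
Local Notation AE := (schurE tau MB ME Z K).
Local Notation Ap := (schurp tau ME Mp G).
Local Notation A := (sysA tau MB ME Mp Z G K).
Local Notation WL := (precWL tau MB ME G K QE Qp).
Local Notation Winv := (invmx (precW tau MB M0 D QE Qp)).

Let t2 : 0 < 2 / tau. Proof. by rewrite divr_gt0. Qed.
Let t2' : 0 < tau / 2. Proof. by rewrite divr_gt0. Qed.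
Let tK : tau / 2 * (2 / tau) = 1. Proof. by field; rewrite gt_eqF. Qed.

Lemma schurB_spd : spd AB.
Proof. by apply: spd_addl; [exact: spd_scale|exact: psd_congr]. Qed.

Lemma schurE_spd : spd AE.
Proof.
rewrite /schurE [X in spd (X + _)]addrC -addrA; apply: spd_addl.
  exact: spd_scale.
apply: psd_add => //; apply: psd_scale; first exact: ltW.
exact/psd_congr/spd_psd.
Qed.

Lemma schurp_spd : spd Ap.
Proof.
rewrite /schurp addrC; apply: spd_addl; first exact: spd_scale.
by apply: psd_scale; [exact: ltW|exact/psd_congr/spd_psd].
Qed.

Lemma precW_inv :
  Winv = block_mx AB 0 0 (block_mx (invmx QE) 0 0 (invmx Qp)).
Proof.
have uQ := spd_unit hQE; have uP := spd_unit hQp; have uA := spd_unit schurB_spd.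
have uQP : block_mx QE 0 0 Qp \in unitmx.
  by rewrite unitmxE det_ublock unitrM -!unitmxE uQ.
rewrite /precW row_mx0 col_mx0 invmx_block_diag ?invmx_block_diag //.
  by rewrite invmxK.
by rewrite unitmxE det_ublock unitrM -!unitmxE unitmx_inv uA.
Qed.

Lemma ip_precW_inv B E p B' E' p' :
  ip Winv (col_mx B (col_mx E p)) (col_mx B' (col_mx E' p'))
  = ip AB B B' + ip (invmx QE) E E' + ip (invmx Qp) p p'.
Proof.
rewrite precW_inv ip_dot !mul_block_col !mul0mx !addr0 !add0r.
by rewrite !dot_col addrA.
Qed.

Lemma ip_precW_inv_gt0 B E p : col_mx B (col_mx E p) != 0 ->
  0 < ip Winv (col_mx B (col_mx E p)) (col_mx B (col_mx E p)).
Proof.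
rewrite ip_precW_inv => x0.
have [_ pB] := spd_psd schurB_spd.
have [_ pE] := spd_psd (spd_inv hQE); have [_ pp] := spd_psd (spd_inv hQp).
rewrite lt0r !addr_ge0 // andbT; apply: contra_neq x0 => /eqP.
rewrite !paddr_eq0 ?addr_ge0 // => /andP[/andP[/eqP B0 /eqP E0] /eqP p0].
rewrite (ip_eq0 schurB_spd B0) (ip_eq0 (spd_inv hQE) E0) (ip_eq0 (spd_inv hQp) p0).
by rewrite !col_mx0.
Qed.

(** The factor [tau / 2] makes [AE *m gradp p] equal to the coupling term [ME *m G *m p]. After
    elimination of B the electric row is thus [AE] applied to [E + gradp p]. *)
Let gradp (p : 'cV[R]_np) : 'cV[R]_nE := (tau / 2) *: (G *m p).

(** On gradients the curl part of [AE] dies by [KG] and the impedance part by [ZG], so only the mass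
    term remains. *)
Let AG : AE *m G = (2 / tau) *: (ME *m G).
Proof.
rewrite /schurE !mulmxDl ZG addr0 -scalemxAl -!mulmxA KG !mulmx0 scaler0 add0r.
by rewrite scalemxAl.
Qed.

(** Forward substitution without computing the inverse: both sides are multiplied by the lower
    triangular factor [L], and the three block rows are compared. *)
Lemma precWL_sysA (B : 'cV_nB) (E : 'cV_nE) p (yE := QE *m (AE *m (E + gradp p))) :
  WL *m A *m col_mx B (col_mx E p) = col_mx (B + (tau / 2) *: (K *m E))
   (col_mx yE (Qp *m (Ap *m p + (tau / 2) *: (G^T *m (AE *m (yE - E - gradp p)))))).
Proof.
have uQ := spd_unit hQE; have uP := spd_unit hQp; have uB := spd_unit hMB.
rewrite -mulmxA /precWL row_mx0; set L := block_mx _ _ _ _.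
have uL : L \in unitmx.
  rewrite unitmxE /L !det_lblock !unitrM -!unitmxE !unitmx_inv uQ uP !andbT.
  by rewrite unitmxE detZ unitrM -unitmxE uB andbT unitrX ?unitfE ?gt_eqF.
rewrite -[RHS](mulKmx uL); congr (_ *m _).
rewrite /L /sysA !mul_block_col !mul_row_col !mul_col_mx.
rewrite !mul0mx !addr0 add_col_mx add0r !mulKmx //.
have MKE : (2 / tau) *: MB *m (B + (tau / 2) *: (K *m E))
    = (2 / tau) *: MB *m B + MB *m K *m E.
  rewrite mulmxDr; congr (_ + _).
  by rewrite -scalemxAl -scalemxAr scalerA mulrC tK scale1r mulmxA.
have AGp : AE *m gradp p = ME *m G *m p.
  by rewrite /gradp -scalemxAr mulmxA AG -scalemxAl scalerA tK scale1r.
have GA : G^T *m AE = (2 / tau) *: (G^T *m ME).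
  rewrite -[LHS]trmxK trmx_mul trmxK (spd_psd schurE_spd).1 AG linearZ /= trmx_mul.
  by rewrite hME.1.
have GM v : (tau / 2) *: (G^T *m (AE *m v)) = G^T *m (ME *m v).
  by rewrite mulmxA GA -scalemxAl scalerA tK scale1r mulmxA.
have App : Ap *m p = G^T *m (ME *m gradp p) + (2 / tau) *: Mp *m p.
  by rewrite /schurp mulmxDl /gradp -!scalemxAr -scalemxAl -!mulmxA.
rewrite GM MKE.
rewrite -/(gradp p).
(* The curl term carried over from the first row cancels the curl-curl part of [AE *m E]. *)
have YE : - K^T *m MB *m (B + (tau / 2) *: (K *m E)) + AE *m (E + gradp p)
   = - K^T *m MB *m B + (((2 / tau) *: ME + Z) *m E + ME *m G *m p).
  rewrite mulmxDr -addrA; congr (_ + _).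
  rewrite mulmxDr AGp addrA; congr (_ + _).
  rewrite /schurE -[in LHS]addrA mulmxDl addrA -[RHS]add0r; congr (_ + _).
  by rewrite -scalemxAr !mulNmx -scalemxAl -!mulmxA scalerN addNr.
(* The unknown [yE] enters the last row twice with opposite signs, and so does the gradient part of
   [Ap *m p]. *)
have YP : - G^T *m ME *m yE + (Ap *m p + G^T *m (ME *m (yE - E - gradp p)))
   = - G^T *m ME *m E + (2 / tau) *: Mp *m p.
  rewrite App !mulmxBr !mulNmx -!mulmxA.
  move: (G^T *m (ME *m yE)) (G^T *m (ME *m E)) (G^T *m (ME *m _)) => a e g.
  move: (_ *: Mp *m p) => m; apply/matrixP => i j; rewrite !mxE; ring.
by rewrite add_col_mx add0r YE YP.
Qed.

(** The square of the left side is exactly the gradient part of the [Ap]-energy of p; the mass part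
    that is left over is nonnegative. *)
Lemma ipnorm_gradp p : ipnorm AE (gradp p) <= ipnorm Ap p.
Proof.
apply: ler_wsqrtr; rewrite {1}/gradp ipZl ipZr ip_dot mulmxA AG -scalemxAl dotZl.
rewrite -mulmxA (mulrA _ (2 / tau)) tK mul1r /schurp ip_addmx !ip_scalemx ip_congr.
rewrite lerDl mulr_ge0 ?(ltW t2) //; exact: (spd_psd hMp).2.
Qed.

(** By [DK] the divergence part of [AB] vanishes on curls. What remains is the curl part of the
    [AE]-energy, up to nonnegative mass and impedance terms. *)
Lemma ipnorm_curl E : ipnorm AB ((tau / 2) *: (K *m E)) <= ipnorm AE E.
Proof.
apply: ler_wsqrtr; rewrite ipZl ipZr /schurB /schurE !ip_addmx !ip_scalemx.
rewrite !ip_congr mulmxA DK mul0mx ip0l addr0 (mulrA _ (2 / tau)) tK mul1r -addrA.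
rewrite lerDl addr_ge0 //; last exact: hZ.2.
by apply: mulr_ge0; [exact: ltW|exact: (spd_psd hME).2].
Qed.

(** * Coercivity and boundedness of the preconditioned operator *)

Section Bounds.
Variables (c1E c2E c1p c2p rho : R).
Hypotheses (c1E0 : 0 < c1E) (c2E0 : 0 < c2E) (c1p0 : 0 < c1p) (c2p0 : 0 < c2p).
Hypothesis hE : forall E : 'cV[R]_nE,
  c1E * ip QE E E <= ip (invmx AE) E E <= c2E * ip QE E E.
Hypothesis hp : forall p : 'cV[R]_np,
  c1p * ip Qp p p <= ip (invmx Ap) p p <= c2p * ip Qp p p.
Hypothesis hrho : rho < Num.sqrt 3 - 1.
Hypothesis hT : (opnorm AE (1%:M - QE *m AE) <= rho%:E)%E.

Variables (B : 'cV[R]_nB) (E : 'cV[R]_nE) (p : 'cV[R]_np).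
Let T := 1%:M - QE *m AE.
Let g := gradp p.
Let u := E + g.
Let b := ipnorm AB B.
Let e := ipnorm AE E.
Let r := ipnorm AE u.
Let q := ipnorm Ap p.
(** The energy for the three Schur complements. It mediates between numerator and denominator:
    [xW_le] and [xW_ge] compare it with the W^-1 norm, with constants that involve only the spectral
    bounds. *)
Let S := b ^+ 2 + e ^+ 2 + q ^+ 2.
Let x := col_mx B (col_mx E p).

Let rho0 : 0 <= rho.
Proof. by have := le_trans (opnorm_ge0 _ _) hT; rewrite lee_fin. Qed.

(** The smallness assumption on rho, in the form that makes the quadratic form in [form_ge] positive
    definite. *)
Let rho3 : (1 + rho) ^+ 2 < 3.
Proof.
rewrite -[X in _ < X]sqr_sqrtr // ltr_sqr ?nnegrE ?sqrtr_ge0 ?addr_ge0 //.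
by rewrite addrC -ltrBrDr.
Qed.

Let psB := spd_psd schurB_spd.
Let psE := spd_psd schurE_spd.
Let psp := spd_psd schurp_spd.

Let b0 : 0 <= b. Proof. exact: ipnorm_ge0. Qed.
Let e0 : 0 <= e. Proof. exact: ipnorm_ge0. Qed.
Let r0 : 0 <= r. Proof. exact: ipnorm_ge0. Qed.
Let q0 : 0 <= q. Proof. exact: ipnorm_ge0. Qed.
Let a0 : 0 <= ipnorm AE g. Proof. exact: ipnorm_ge0. Qed.
Let aq : ipnorm AE g <= q. Proof. exact: ipnorm_gradp. Qed.

Let r_le : r <= e + q.
Proof. by apply: le_trans (ipnormD _ _ psE) _; rewrite lerD2l. Qed.

Let e_le : e <= r + q.
Proof.
rewrite /e -[E](addrK g) -/u; apply: le_trans (ipnormD _ _ psE) _.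
by rewrite ipnormN lerD2l.
Qed.

Let Ku : K *m u = K *m E.
Proof. by rewrite mulmxDr /g /gradp -scalemxAr mulmxA KG mul0mx scaler0 addr0. Qed.

(** Bounding the curl by the norm of u instead of that of E keeps the final quadratic form in the
    three variables b, r, q. *)
Let curl_le : ipnorm AB ((tau / 2) *: (K *m E)) <= r.
Proof. by rewrite -Ku; exact: ipnorm_curl. Qed.

Let Tu_le : ipnorm AE (T *m u) <= rho * r.
Proof. exact: opnorm_le schurE_spd hT. Qed.

Let yE_eq : QE *m (AE *m u) = u - T *m u.
Proof. by rewrite /T mulmxBl mul1mx opprB addrCA subrr addr0 mulmxA. Qed.

Let s := Ap *m p - (tau / 2) *: (G^T *m (AE *m (T *m u))).

Let WLA : WL *m A *m x =
  col_mx (B + (tau / 2) *: (K *m E)) (col_mx (u - T *m u) (Qp *m s)).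
Proof.
rewrite precWL_sysA -/g -/u; congr col_mx; congr col_mx; first exact: yE_eq.
have -> : QE *m (AE *m u) - E - g = - (T *m u).
  by rewrite yE_eq -addrA -opprD -/u addrAC subrr add0r.
by rewrite !mulmxN scalerN.
Qed.

(** Moving [G^T] and [tau / 2] onto the test vector turns it into [gradp v], so that s is only ever
    estimated through [AE] and [Ap] norms. *)
Let dot_s v : dot s v = ip Ap p v - ip AE (T *m u) (gradp v).
Proof.
by rewrite /s dotDl dotNl dotZl (dot_adj G^T) trmxK /gradp !ip_dot dotZr.
Qed.

Let xW : ip Winv x x = b ^+ 2 + ip (invmx QE) E E + ip (invmx Qp) p p.
Proof. by rewrite ip_precW_inv sqr_ipnorm. Qed.

Let xW_le : ip Winv x x <= (1 + c2E + c2p) * S.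
Proof.
have /andP[_ hE2] := ip_invmx_bounds schurE_spd hQE c1E0 c2E0 hE E.
have /andP[_ hp2] := ip_invmx_bounds schurp_spd hQp c1p0 c2p0 hp p.
rewrite -(sqr_ipnorm _ psE) -/e in hE2; rewrite -(sqr_ipnorm _ psp) -/q in hp2.
rewrite xW /S; have b2 := sqr_ge0 b; have e2 := sqr_ge0 e; have q2 := sqr_ge0 q.
have := mulr_ge0 (ltW c2E0) (addr_ge0 b2 q2).
have := mulr_ge0 (ltW c2p0) (addr_ge0 b2 e2).
move: (b ^+ 2) (e ^+ 2) (q ^+ 2) b2 e2 q2 hE2 hp2 => b2 e2 q2; lra.
Qed.

Let xW_ge : S <= (1 + c1E^-1 + c1p^-1) * ip Winv x x.
Proof.
have /andP[hE1 _] := ip_invmx_bounds schurE_spd hQE c1E0 c2E0 hE E.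
have /andP[hp1 _] := ip_invmx_bounds schurp_spd hQp c1p0 c2p0 hp p.
rewrite -(sqr_ipnorm _ psE) -/e in hE1; rewrite -(sqr_ipnorm _ psp) -/q in hp1.
have iE := (spd_psd (spd_inv hQE)).2 E; have ip_ := (spd_psd (spd_inv hQp)).2 p.
rewrite mulrC -ler_pdivlMr // in hE1.
rewrite mulrC -ler_pdivlMr // in hp1.
have iE0 : 0 < c1E^-1 by rewrite invr_gt0.
have ip0 : 0 < c1p^-1 by rewrite invr_gt0.
rewrite xW /S; have b2 := sqr_ge0 b.
have := mulr_ge0 (ltW iE0) (addr_ge0 b2 ip_).
have := mulr_ge0 (ltW ip0) (addr_ge0 b2 iE).
move: (b ^+ 2) (e ^+ 2) (q ^+ 2) b2 hE1 hp1 => b2 e2 q2; lra.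
Qed.

(** The weight W^-1 cancels [QE] and [Qp], which leaves pairings in the three energy norms. The
    negative terms are a curl coupling, at most b r, and two gradient couplings, at most r q and rho
    r q. *)
Let form_ge :
  b ^+ 2 - b * r + r ^+ 2 - (1 + rho) * r * q + q ^+ 2 <= ip Winv (WL *m A *m x) x.
Proof.
rewrite WLA ip_precW_inv -yE_eq !(ip_dot (invmx _)) !mulKmx ?spd_unit // -ip_dot.
rewrite dot_s -/g ipDl -!sqr_ipnorm // -/b -/q.
(* Substitution of E = u - g. *)
have -> : ip AE u E = r ^+ 2 - ip AE u g.
  by rewrite sqr_ipnorm // -[in LHS](addrK g E) -/u ipDr ipNr.
have hB : - (b * r) <= ip AB ((tau / 2) *: (K *m E)) B.
  rewrite lerNl; apply: le_trans (ler_norm _) _; rewrite normrN [b * r]mulrC.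
  by apply: le_trans (ler_ipnorm _ _ psB) _; apply: ler_wpM2r.
have hu : ip AE u g <= r * q.
  apply: le_trans (ler_norm _) _; apply: le_trans (ler_ipnorm _ _ psE) _.
  exact: ler_wpM2l.
have ht : ip AE (T *m u) g <= rho * r * q.
  apply: le_trans (ler_norm _) _; apply: le_trans (ler_ipnorm _ _ psE) _.
  by apply: ler_pM => //; exact: ipnorm_ge0.
rewrite mulrDl mul1r mulrDl.
move: hB hu ht; move: (b * r) (r * q) (rho * r * q) => z1 z2 z3; lra.
Qed.

Lemma precWL_coercive :
  (3 - (1 + rho) ^+ 2) / (24 * (1 + c2E + c2p)) * ip Winv x x
  <= ip Winv (WL *m A *m x) x.
Proof.
apply: le_trans form_ge.
(* With an eighth of the gap, (1 + rho)^2 = 3 - 8 d, and the coefficient of r^2 left after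
   completing the squares is exactly d^2. *)
pose d := (3 - (1 + rho) ^+ 2) / 8.
have d0 : 0 < d by rewrite divr_gt0 // subr_gt0.
have -> : (3 - (1 + rho) ^+ 2) / (24 * (1 + c2E + c2p)) =
    d / 3 / (1 + c2E + c2p).
  by rewrite /d; field; rewrite gt_eqF // !addr_gt0.
have C0 : 0 < 1 + c2E + c2p by rewrite !addr_gt0.
apply: (@le_trans _ _ (d / 3 * S)).
  rewrite mulrAC ler_pdivrMr // -[leRHS]mulrA [S * _]mulrC; apply: ler_wpM2l => //.
  by rewrite divr_ge0 // ltW.
(* Since e <= r + q, the energy [S] is at most b^2 + 2 r^2 + 3 q^2; this accounts for the factor
   3. *)
apply: (@le_trans _ _ (d * (b ^+ 2 + r ^+ 2 + q ^+ 2))).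
  rewrite -mulrA ler_wpM2l ?(ltW d0) //.
  have : e ^+ 2 <= (r + q) ^+ 2 by rewrite ler_sqr ?nnegrE ?addr_ge0.
  have := (sqr_ge0 (r - q), sqr_ge0 b) => -[]; rewrite /S; nra.
have d1 : d < 1 by rewrite /d; have := sqr_ge0 (1 + rho); nra.
have dE : (1 + rho) ^+ 2 = 3 - 8 * d by rewrite /d; field.
rewrite -subr_ge0 -(pmulr_rge0 _ (_ : 0 < 1 - d)) ?subr_gt0 //.
(* complete the squares in b and in q *)
have -> : (1 - d) * (b ^+ 2 - b * r + r ^+ 2 - (1 + rho) * r * q + q ^+ 2
     - d * (b ^+ 2 + r ^+ 2 + q ^+ 2)) =
  ((1 - d) * b - r / 2) ^+ 2 + ((1 - d) * q - (1 + rho) * r / 2) ^+ 2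
  + ((1 - d) ^+ 2 - (1 + (1 + rho) ^+ 2) / 4) * r ^+ 2 by field.
rewrite !addr_ge0 ?sqr_ge0 // mulr_ge0 ?sqr_ge0 // dE.
have := sqr_ge0 d; lra.
Qed.

(** The constant collects one summand per block: 2 from (b + e)^2, 8 from (2 r)^2 and 6 from (q +
    r)^2, with r^2 <= 2 (e^2 + q^2). *)
Let y_le : ip Winv (WL *m A *m x) (WL *m A *m x) <= (2 + 8 * c2E + 6 / c1p) * S.
Proof.
rewrite WLA ip_precW_inv (ip_dot (invmx Qp)) mulKmx ?spd_unit //.
have rho1 : rho < 1 by move: rho0 rho3; nra.
have hB : ip AB (B + (tau / 2) *: (K *m E)) (B + (tau / 2) *: (K *m E))
    <= 2 * S.
  rewrite -sqr_ipnorm //; apply: (@le_trans _ _ ((b + e) ^+ 2)).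
    rewrite ler_sqr ?nnegrE ?addr_ge0 ?ipnorm_ge0 //.
    by apply: le_trans (ipnormD _ _ psB) _; rewrite lerD2l ipnorm_curl.
  by rewrite /S; have := (sqr_ge0 (b - e), sqr_ge0 q) => -[]; nra.
have r2 : r ^+ 2 <= 2 * (e ^+ 2 + q ^+ 2).
  have : r ^+ 2 <= (e + q) ^+ 2 by rewrite ler_sqr ?nnegrE ?addr_ge0.
  have := sqr_ge0 (e - q); nra.
have hyE : ip (invmx QE) (u - T *m u) (u - T *m u) <= 8 * c2E * S.
  have /andP[_ /le_trans] := ip_invmx_bounds schurE_spd hQE c1E0 c2E0 hE (u - T *m u).
  apply; rewrite [8 * _]mulrC -[leRHS]mulrA ler_wpM2l ?(ltW c2E0) // -sqr_ipnorm //.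
  apply: (@le_trans _ _ ((2 * r) ^+ 2)).
    rewrite ler_sqr ?nnegrE ?mulr_ge0 ?ipnorm_ge0 //.
    apply: le_trans (ipnormD _ _ psE) _; rewrite ipnormN.
    by have := Tu_le; move: r0; rewrite -/r; nra.
  by rewrite /S; have := sqr_ge0 b; move: r2; rewrite exprMn; lra.
have hyp : dot s (Qp *m s) <= 6 / c1p * S.
  have /andP[] := hp s; rewrite dotC -ip_dot mulrC -ler_pdivlMr // => /le_trans + _.
  apply; rewrite mulrAC ler_pM2r ?invr_gt0 //.
  rewrite ip_invmx //; last exact: schurp_spd.
  (* The Riesz representative of s for [Ap]; testing s against it bounds its norm by q + r. *)
  set v := invmx Ap *m s.
  have vv : ip Ap v v <= (q + r) * ipnorm Ap v.
    rewrite -[X in X <= _]/(dot (Ap *m v) v) mulKVmx ?spd_unit //; last exact: schurp_spd.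
    rewrite dot_s mulrDl lerD //.
      by apply: le_trans (ler_norm _) _; exact: ler_ipnorm.
    apply: le_trans (ler_norm _) _; rewrite normrN.
    apply: le_trans (ler_ipnorm _ _ psE) _; apply: ler_pM; rewrite ?ipnorm_ge0 //.
      by apply: le_trans Tu_le _; rewrite ler_piMl // ltW.
    exact: ipnorm_gradp.
  have vq : ipnorm Ap v <= q + r.
    have [v0|v0] := eqVneq (ipnorm Ap v) 0; first by rewrite v0 addr_ge0.
    have {}v0 : 0 < ipnorm Ap v by rewrite lt_def v0 ipnorm_ge0.
    by rewrite -(ler_pM2r v0) -expr2 sqr_ipnorm.
  apply: (@le_trans _ _ ((q + r) ^+ 2)).
    by rewrite -sqr_ipnorm // ler_sqr ?nnegrE ?addr_ge0 ?ipnorm_ge0.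
  rewrite /S; have := (sqr_ge0 (q - r), sqr_ge0 b) => -[].
  move: r2 (sqr_ge0 e) (sqr_ge0 q); nra.
by rewrite [leRHS]mulrDl [X in _ <= X + _]mulrDl; do 2![apply: lerD => //].
Qed.

Lemma precWL_bounded :
  ip Winv (WL *m A *m x) (WL *m A *m x)
  <= (2 + 8 * c2E + 6 / c1p) * (1 + c1E^-1 + c1p^-1) * ip Winv x x.
Proof.
apply: le_trans y_le _; rewrite -[leRHS]mulrA ler_wpM2l //.
by rewrite !addr_ge0 ?divr_ge0 ?mulr_ge0 ?ltW.
Qed.

End Bounds.
End PreconditionedSystem.

(** * Vanishing polynomials *)

Section PolynomialsOnLines.
Set Implicit Arguments.
Unset Strict Implicit.
Unset Printing Implicit Defensive.
Context {R : realType} {n : nat}.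
Local Notation pol := (mpoly n R).
Implicit Types (p q : pol) (x d v : 'I_n -> R).

Lemma mpoly_alg_ind (P : pol -> Prop) :
  (forall c, P (mpolyC n c)) -> (forall i, P (mpolyX R (mnm1 i))) ->
  (forall p q, P p -> P q -> P (p + q)) ->
  (forall p q, P p -> P q -> P (p * q)) -> forall p, P p.
Proof.
move=> PC PX PD PM p; elim/mpolyind: p => [|c m p _ _ Pp].
  by rewrite -(mpolyC0 n R); exact: PC.
apply: (PD) => //; rewrite -mul_mpolyC; apply: (PM); first exact: PC.
have P1 : P 1 by rewrite -(mpolyC1 n R); exact: PC.
rewrite mpolyXE_id; apply: big_ind => [//||i _]; first exact: PM.
by elim: (m i) => [|k IHk]; rewrite ?expr0 // exprS; apply: PM.
Qed.

(** The restriction of p to the line through x with direction d, as a polynomial in the line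
    parameter. It reduces vanishing questions to counting roots in one variable. *)
Definition linepoly x d p : {poly R} :=
  mmap polyC (fun i => (x i)%:P + d i *: 'X) p.

Lemma linepolyC x d c : linepoly x d (mpolyC n c) = c%:P.
Proof. exact: mmapC. Qed.

Lemma linepolyX x d i : linepoly x d (mpolyX R (mnm1 i)) = (x i)%:P + d i *: 'X.
Proof. by rewrite /linepoly mmapX mmap1U. Qed.

Lemma linepolyD x d p q : linepoly x d (p + q) = linepoly x d p + linepoly x d q.
Proof. exact: mmapD. Qed.

Lemma linepolyM x d p q : linepoly x d (p * q) = linepoly x d p * linepoly x d q.
Proof. exact: rmorphM. Qed.

Lemma horner_linepoly x d p t :
  (linepoly x d p).[t] = meval (fun i => x i + t * d i) p.
Proof.
elim/mpoly_alg_ind: p => [c|i|p q Pp Pq|p q Pp Pq].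
- by rewrite linepolyC hornerC mevalC.
- by rewrite linepolyX mevalXU !hornerE mulrC.
- by rewrite linepolyD hornerD Pp Pq mevalD.
- by rewrite linepolyM hornerM Pp Pq mevalM.
Qed.

(** The chain rule, checked on constants and variables and passed through sums and products. *)
Lemma deriv_linepoly x d p :
  (linepoly x d p)^`() = \sum_i d i *: linepoly x d (mderiv i p).
Proof.
elim/mpoly_alg_ind: p => [c|i|p q Pp Pq|p q Pp Pq].
- rewrite linepolyC derivC big1 // => i _.
  by rewrite mderivC -(mpolyC0 n R) linepolyC scaler0.
- rewrite linepolyX derivD derivC add0r derivZ derivX (bigD1 i) //= big1 ?addr0.
    rewrite mderivX mnm1E eqxx scale1r -{1}[mnm1 i]add0m addmK.
    by rewrite mpolyX0 -(mpolyC1 n R) linepolyC alg_polyC.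
  move=> j ji; rewrite mderivX mnm1E eq_sym (negPf ji) scale0r.
  by rewrite -(mpolyC0 n R) linepolyC scaler0.
- rewrite linepolyD derivD Pp Pq -big_split /=; apply: eq_bigr => i _.
  by rewrite mderivD linepolyD scalerDr.
- rewrite linepolyM derivM Pp Pq mulr_suml mulr_sumr -big_split /=.
  apply: eq_bigr => i _; rewrite mderivM linepolyD !linepolyM scalerDr.
  by rewrite -scalerAl -scalerAr.
Qed.

(** The points e / (i + 1) for i below [size f] are distinct roots, and there are more of them than
    the degree allows. *)
Lemma poly_interval_eq0 (f : {poly R}) e : 0 < e ->
  (forall t, 0 <= t <= e -> f.[t] = 0) -> f = 0.
Proof.
move=> e0 f0; pose s := [seq e / i.+1%:R | i <- iota 0 (size f)].
have us : uniq s.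
  rewrite map_inj_uniq ?iota_uniq // => i j /(mulfI (lt0r_neq0 e0))/invr_inj/eqP.
  by rewrite eqr_nat => /eqP[].
apply: (roots_geq_poly_eq0 _ us); last by rewrite size_map size_iota.
apply/allP => _ /mapP[i _ ->]; apply/rootP/f0.
rewrite divr_ge0 ?(ltW e0) //= ler_pdivrMr // ler_peMr ?(ltW e0) //.
by rewrite ler1n.
Qed.

Lemma mderiv_eq0_along x d p :
  (forall t, meval (fun i => x i + t * d i) p = 0) ->
  \sum_i d i * meval x (mderiv i p) = 0.
Proof.
move=> h; have l0 : linepoly x d p = 0.
  by apply: (@poly_interval_eq0 _ 1) => // t _; rewrite horner_linepoly.
have := congr1 (horner^~ 0) (deriv_linepoly x d p).
rewrite l0 deriv0 horner0 horner_sum => h0; rewrite [RHS]h0.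
apply: eq_bigr => i _; rewrite hornerZ horner_linepoly; congr (_ * _).
by apply: meval_eq => j; rewrite mul0r addr0.
Qed.

Lemma meval_segment_eq0 x d p e : 0 < e ->
  (forall t, 0 <= t <= e -> meval (fun i => x i + t * d i) p = 0) ->
  forall t, meval (fun i => x i + t * d i) p = 0.
Proof.
move=> e0 h t; rewrite -horner_linepoly (@poly_interval_eq0 (linepoly x d p) e) //.
  by rewrite horner0.
by move=> s hs; rewrite horner_linepoly h.
Qed.

(** Induction on the size: the partial derivatives vanish at every point, hence are zero as
    polynomials, so that p is constant, and its value at 0 is 0. *)
Lemma meval_eq0 p : (forall v, meval v p = 0) -> p = 0.
Proof.
have [k] := ubnP (msize p); elim: k p => // k IHk p pk h.
have d0 i : mderiv i p = 0.
  have [->|p0] := eqVneq p 0; first exact: mderiv0.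
  apply: IHk => [|v].
    apply: (@leq_trans (msize p)) => //; rewrite ltnS in pk.
    rewrite msizeE; apply: (@leq_ltn_trans (msize p).-1).
      apply/bigmax_leqP_seq => m + _; rewrite mcoeff_msupp mcoeff_deriv => m0.
      have : mnm_add m (mnm1 i) \in msupp p.
        by rewrite mcoeff_msupp; apply: contraNneq m0 => ->; rewrite mul0rn.
      by move=> /msize_mdeg_lt; rewrite mdegD mdeg1 addn1 ltn_predRL.
    by rewrite prednK // lt0n msize_poly_eq0.
  have := @mderiv_eq0_along v (fun j => (j == i)%:R) p.
  rewrite (bigD1 i) //= eqxx mul1r big1 ?addr0 => [|j /negPf->]; last by rewrite mul0r.
  by apply.
(* If the exponent of variable i in m is not zero, the coefficient of p at m appears, up to a
   positive integer factor, in the i-th derivative. *)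
have pE : p = mpolyC n (mcoeff (mnm0 (n:=n)) p).
  apply/mpolyP => m; rewrite mcoeffC.
  have [->|m0] := eqVneq m (mnm0 (n:=n)); first by rewrite mulr1.
  have [i mi] : exists i, m i != 0%N.
    apply/existsP; apply: contra_neqT m0; rewrite negb_exists => /forallP m0.
    by apply/mnmP => i; rewrite mnm0E; apply/eqP; rewrite -[_ == _]negbK.
  have := congr1 (mcoeff (mnm_sub m (mnm1 i))) (d0 i).
  rewrite mcoeff_deriv mcoeff0 submK ?lep1mP // => /eqP.
  rewrite mulrn_eq0 /= => /eqP ->.
  by rewrite mulr0.
by have := h (fun=> 0); rewrite pE mevalC => ->; rewrite mpolyC0.
Qed.

End PolynomialsOnLines.

(** * Integrals over simplices and triangles *)

Section IntegralsOfContinuousFunctions.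
Set Implicit Arguments.
Unset Strict Implicit.
Unset Printing Implicit Defensive.
Context {R : realType} d (T : measurableType d) (n : nat) (phi : T -> 'rV[R]_n).
Hypothesis mphi : forall i, measurable_fun setT (fun t => phi t 0 i).
Implicit Types (U K : set 'rV[R]_n) (A : set T) (f : 'rV[R]_n -> R).

(** Only the coordinates of [phi] are known to be measurable. An open set is the union of the
    countably many cells of rational centre and radius 1/(k + 1) inside it, and a cell of the sup
    norm is cut out by finitely many coordinate conditions. *)
Lemma measurable_preimage_open U : open U -> measurable (phi @^-1` U).
Proof.
move=> oU; pose cell (q : 'rV[rat]_n * nat) : set 'rV[R]_n :=
  ball (map_mx ratr q.1 : 'rV[R]_n) (q.2.+1%:R^-1 : R).
pose F q := if `[< cell q `<=` U >] then phi @^-1` (cell q) else set0.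
have -> : phi @^-1` U = \bigcup_q F q.
  apply/seteqP; split=> [t /= Ut|t [q _]]; last first.
    by rewrite /F; case: asboolP => // qU; exact: qU.
  have /nbhs_ballP[e /= e0 eU] := open_nbhs_nbhs (conj oU Ut).
  (* Twice the radius stays below e, so a cell that contains [phi t] lies in the ball of radius e
     around [phi t]. *)
  have [k ke] : exists k : nat, 2 * (k.+1%:R^-1 : R) < e.
    have [|k] := @ltr_add_invr _ 0 (e / 2); first by rewrite divr_gt0.
    by rewrite add0r ltr_pdivlMr // mulrC; exists k.
  have hq i : exists q : rat, `|ratr q - phi t 0 i| < (k.+1%:R^-1 : R).
    have [|q] := @rat_in_itvoo R (phi t 0 i - k.+1%:R^-1) (phi t 0 i + k.+1%:R^-1).
      by rewrite ltrBlDr -addrA ltrDl addr_gt0 // invr_gt0.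
    by rewrite in_itv /= => /andP[q1 q2]; exists q; rewrite ltr_distl q1 q2.
  pose q : 'rV[rat]_n := \row_i xchoose (hq i).
  have kq : ball (map_mx ratr q : 'rV[R]_n) (k.+1%:R^-1 : R) (phi t).
    split=> [|i j]; first by rewrite invr_gt0.
    by rewrite ord1 !mxE; exact: (xchooseP (hq j)).
  exists (q, k) => //; rewrite /F asboolT //.
  move=> y /= yq; apply: eU; apply: (le_ball (ltW ke)).
  by rewrite mulr_natl mulr2n; apply: ball_triangle yq; exact: ball_sym.
apply: countable_bigcupT_measurable; first exact: countableP.
move=> q; rewrite /F; case: ifP => // _.
have -> : phi @^-1` (cell q) = \bigcap_(i in [set: 'I_n])
    [set t | `|ratr (q.1 0 i) - phi t 0 i| < (q.2.+1%:R^-1 : R)].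
  apply/seteqP; split=> [t [_ tq] i _|t tq].
    by have := tq 0 i; rewrite !mxE.
  split=> [|i j]; first by rewrite invr_gt0.
  by have := tq j I; rewrite ord1 !mxE.
apply: fin_bigcap_measurable => // i _.
rewrite -[X in measurable X]setTI; apply: (@measurable_fun_ltr _ _ R setT
  (fun t => `|ratr (q.1 0 i) - phi t 0 i|)
  (fun=> q.2.+1%:R^-1) _ _ measurableT [set true]) => //.
by apply: measurableT_comp => //; exact: measurable_funB.
Qed.

Lemma measurable_preimage_closed K : closed K -> measurable (phi @^-1` K).
Proof.
move=> cK; rewrite -[K]setCK preimage_setC; apply: measurableC.
exact: (measurable_preimage_open (closed_openC cK)).
Qed.

Lemma measurable_fun_within K A f : measurable A -> (forall t, A t -> K (phi t)) ->
  {within K, continuous f} -> measurable_fun A (f \o phi).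
Proof.
move=> mA AK /continuousP cf; apply: (measurability _ (RGenOpens.measurableE R)).
move=> _ [_ [a [b ->] <-]].
have /open_subspaceP[V oV VK] := cf _ (@interval_open _ (BRight a) (BLeft b) isT isT).
have -> : A `&` (f \o phi) @^-1` `]a, b[%classic = A `&` phi @^-1` V.
  apply/seteqP; split=> t [At ft]; split=> //.
    by have [] : (V `&` K) (phi t) by rewrite VK; split=> //; exact: AK.
  by have [] : ((f @^-1` `]a, b[%classic) `&` K) (phi t) by rewrite -VK; split=> //; exact: AK.
by apply: measurableI => //; exact: measurable_preimage_open.
Qed.

(** A continuous function on a compact set is bounded, and bounded measurable functions are
    integrable on sets of finite measure. *)
Lemma integrable_within (mu : {measure set T -> \bar R}) K A f :
  measurable A -> (mu A < +oo)%E -> (forall t, A t -> K (phi t)) -> compact K ->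
  {within K, continuous f} -> mu.-integrable A (EFin \o (f \o phi)).
Proof.
move=> mA Afin AK cK cf; apply: measurable_bounded_integrable => //.
  exact: measurable_fun_within cf.
have [M [Mr hM]] := compact_bounded (continuous_compact cf cK).
exists M; split=> // x Mx t At /=; apply: hM => //.
by exists (phi t) => //; exact: AK.
Qed.

End IntegralsOfContinuousFunctions.

Section IntegralPositivity.
Set Implicit Arguments.
Unset Strict Implicit.
Unset Printing Implicit Defensive.

(** The integral over [A] dominates the one over [B], which is at least c times the measure of
    [B]. *)
Lemma Rintegral_gt0 d (T : measurableType d) (R : realType)
    (mu : {measure set T -> \bar R}) (A B : set T) (f : T -> R) (c : R) :
  measurable A -> measurable B -> B `<=` A -> mu.-integrable A (EFin \o f) ->
  (forall t, A t -> 0 <= f t) -> 0 < c -> (forall t, B t -> c <= f t) ->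
  (0 < mu B)%E -> 0 < \int[mu]_(t in A) f t.
Proof.
move=> mA mB BA fi f0 c0 cf B0.
have mf : measurable_fun A (EFin \o f) by case/integrableP: fi.
have fin : (\int[mu]_(t in A) (f t)%:E)%E \is a fin_num by exact: integrable_fin_num.
rewrite -lte_fin fineK //.
apply: (@lt_le_trans _ _ (\int[mu]_(t in B) (cst c%:E) t)%E).
  by rewrite integral_cst // mule_gt0.
apply: (@le_trans _ _ (\int[mu]_(t in B) (f t)%:E)%E).
  apply: ge0_le_integral => //.
  - by move=> t _; rewrite lee_fin ltW.
  - by apply: measurable_funS mf.
by apply: ge0_subset_integral => // t At; rewrite lee_fin f0.
Qed.

End IntegralPositivity.

Section Volumes.
Set Implicit Arguments.
Unset Strict Implicit.
Unset Printing Implicit Defensive.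
Context {R : realType}.
Implicit Types (p q : mpoly 3 R) (x c : 'rV[R]_3).

Lemma ev_sum (I : finType) (P : pred I) (F : I -> mpoly 3 R) x :
  ev x (\sum_(i | P i) F i) = \sum_(i | P i) ev x (F i).
Proof. by apply: (big_morph (ev x)); [exact: mevalD|exact: meval0]. Qed.

Lemma ev_continuous p : continuous (fun x => ev x p).
Proof.
rewrite /ev; elim/(@mpoly_alg_ind R 3): p => [c|i|p q Pp Pq|p q Pp Pq].
- rewrite [X in continuous X](_ : _ = cst c); first exact: cst_continuous.
  by apply/funext => x; rewrite mevalC.
- rewrite [X in continuous X](_ : _ = fun x : 'rV[R]_3 => x 0 i).
    exact: coord_continuous.
  by apply/funext => x; rewrite mevalXU.
- rewrite [X in continuous X](_ : _ =
    (fun x => meval (fun i => x 0 i) p) \+ (fun x => meval (fun i => x 0 i) q)).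
    by move=> x; apply: continuousD; [exact: Pp|exact: Pq].
  by apply/funext => x; rewrite mevalD.
- rewrite [X in continuous X](_ : _ =
    (fun x => meval (fun i => x 0 i) p) \* (fun x => meval (fun i => x 0 i) q)).
    by move=> x; apply: continuousM; [exact: Pp|exact: Pq].
  by apply/funext => x; rewrite mevalM.
Qed.

Local Notation R1 := (measurableTypeR R).
Local Notation mu3 :=
  ((lebesgue_measure \x lebesgue_measure) \x lebesgue_measure)%E.

Lemma measurable_pt3 i :
  measurable_fun setT (fun u : R1 * R1 * R1 => pt3 u 0 i : R).
Proof.
case: i => [[|[|[|//]]]] hi; under eq_fun do rewrite mxE /=.
- exact: measurableT_comp.
- exact: measurableT_comp.
- exact: measurable_snd.
Qed.

(** A ball of the sup norm is a cube, and its product measure factors. *)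
Lemma volume_ball c (e : R) : 0 < e ->
  mu3 ((@pt3 R : R1 * R1 * R1 -> _) @^-1` ball c e) = ((2 * e) ^+ 3)%:E.
Proof.
move=> e0.
have -> : (@pt3 R : R1 * R1 * R1 -> _) @^-1` ball c e =
    (ball (c 0 0 : R) e `*` ball (c 0 1 : R) e) `*` ball (c 0 2%:R : R) e.
  apply/seteqP; split=> [u [_ uc]|[[u0 u1] u2] [[h0 h1] h2]].
    by have := (uc 0 0, uc 0 1, uc 0 2%:R); rewrite !mxE /= => -[[]].
  split=> // i j; rewrite ord1 mxE; case: j => [[|[|[|//]]]] hj /=.
  - by move: h0; congr (ball (c 0 _) _ _); apply: val_inj.
  - by move: h1; congr (ball (c 0 _) _ _); apply: val_inj.
  - by move: h2; congr (ball (c 0 _) _ _); apply: val_inj.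
have mb (a : R) : measurable (ball a e : set R1) by exact: measurable_ball.
rewrite product_measure1E //; last exact: measurableX.
rewrite [X in (X * _)%E]product_measure1E //.
transitivity ((e *+ 2)%:E * (e *+ 2)%:E * (e *+ 2)%:E)%E.
  by congr (_ * _ * _)%E; apply: lebesgue_measure_ball; exact: ltW.
rewrite -!EFinM; congr EFin; ring.
Qed.

End Volumes.

(** * Barycentric coordinates of a tetrahedron *)

Section Simplex.
Set Implicit Arguments.
Unset Strict Implicit.
Unset Printing Implicit Defensive.
Context {R : realType} (a : 'I_4 -> 'rV[R]_3).
Implicit Types (p q : mpoly 3 R) (x : 'rV[R]_3).

Let M : 'M[R]_3 := \matrix_(i < 3, j < 3) (a (lift ord0 i) - a ord0) 0 j.
Hypothesis detM : \det M != 0.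

Let uM : M \in unitmx. Proof. by rewrite unitmxE unitfE. Qed.

Definition bary0 x : 'rV[R]_3 := (x - a ord0) *m invmx M.

Definition bary (i : 'I_4) x : R :=
  if unlift ord0 i is Some j then bary0 x 0 j else 1 - \sum_j bary0 x 0 j.

(** Barycentric coordinates as formal polynomials, so that their continuity is an instance of
    [ev_continuous]. *)
Definition baryp0 (i : 'I_3) : mpoly 3 R :=
  \sum_j (Xvec R j - mpolyC 3 (a ord0 0 j)) * mpolyC 3 (invmx M j i).

Definition baryp (i : 'I_4) : mpoly 3 R :=
  if unlift ord0 i is Some j then baryp0 j else 1 - \sum_j baryp0 j.

Lemma ev_baryp i x : ev x (baryp i) = bary i x.
Proof.
have h0 j : ev x (baryp0 j) = bary0 x 0 j.
  rewrite /baryp0 ev_sum /bary0 !mxE; apply: eq_bigr => k _.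
  by rewrite /ev mevalM mevalB mevalXU !mevalC !mxE.
rewrite /baryp /bary; case: unliftP => [j _|_]; first exact: h0.
rewrite /ev mevalB meval1 -!/(ev x _) ev_sum; congr (_ - _); apply: eq_bigr => j _; exact: h0.
Qed.

Let bary_ord0 x : bary ord0 x = 1 - \sum_j bary0 x 0 j.
Proof. by rewrite /bary unlift_none. Qed.

Let bary_lift x j : bary (lift ord0 j) x = bary0 x 0 j.
Proof. by rewrite /bary liftK. Qed.

Lemma sum_bary x : \sum_i bary i x = 1.
Proof.
rewrite big_ord_recl bary_ord0 [X in _ + X](eq_bigr _ (fun j _ => bary_lift x j)).
exact: subrK.
Qed.

Lemma bary_comb x : \sum_i bary i x *: a i = x.
Proof.
rewrite big_ord_recl bary_ord0.
rewrite [X in _ + X](eq_bigr (fun j => bary0 x 0 j *: a (lift ord0 j))); last first.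
  by move=> j _; rewrite bary_lift.
have : bary0 x *m M = x - a ord0 by rewrite mulmxKV.
rewrite mulmx_sum_row => hx.
rewrite scalerBl scale1r scaler_suml -addrA -[RHS](subrKC (a ord0)) -hx.
congr (_ + _); rewrite addrC -sumrB; apply: eq_bigr => i _.
by rewrite -scalerBr; congr (_ *: _); apply/rowP => j; rewrite !mxE.
Qed.

Lemma bary_unique (w : 'I_4 -> R) : \sum_i w i = 1 ->
  forall i, bary i (\sum_i w i *: a i) = w i.
Proof.
move=> w1.
have h j : bary0 (\sum_i w i *: a i) 0 j = w (lift ord0 j).
  suff -> : bary0 (\sum_i w i *: a i) = \row_j w (lift ord0 j) by rewrite mxE.
  rewrite /bary0 -[RHS](mulmxK uM); congr (_ *m _); rewrite mulmx_sum_row.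
  rewrite -[a ord0 in LHS]scale1r -w1 scaler_suml -sumrB big_ord_recl subrr add0r.
  apply: eq_bigr => i _; rewrite -scalerBr mxE; congr (_ *: _).
  by apply/rowP => k; rewrite !mxE.
move=> i; rewrite /bary; case: unliftP => [j ->|->]; first exact: h.
by under eq_bigr do rewrite h; rewrite -w1 big_ord_recl addrK.
Qed.

(** The tetrahedron as an intersection of four half-spaces; closedness and the existence of interior
    points are read off from this form. *)
Lemma hullP x : hull a predT x <-> forall i, 0 <= ev x (baryp i).
Proof.
split=> [[w [w0 _ w1 ->]] i|h]; first by rewrite ev_baryp bary_unique.
exists (bary^~ x); split=> [i|||]; rewrite ?sum_bary ?bary_comb //.
by rewrite -ev_baryp.
Qed.

Lemma closed_hull : closed (hull a predT).
Proof.
rewrite (_ : hull a predT = \bigcap_i ((fun x => ev x (baryp i)) @^-1` [set y | 0 <= y])).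
  apply: closed_bigI => i _; apply: preimage_closed; last exact: closed_ge.
  by move=> x _; exact: ev_continuous.
by apply/seteqP; split=> [x /hullP h i _|x h]; [exact: h|apply/hullP => i; exact: h].
Qed.

Lemma hull_le (i : 'I_4) x : hull a predT x -> `|x| <= \sum_i `|a i|.
Proof.
case=> w [w0 _ w1 ->]; apply: le_trans (ler_norm_sum _ _ _) _; apply: ler_sum => j _.
rewrite normrZ ger0_norm // ler_piMl //.
by rewrite -w1 (bigD1 j) //= lerDl sumr_ge0.
Qed.

Lemma compact_hull : compact (hull a predT).
Proof.
apply: bounded_closed_compact; last exact: closed_hull.
exists (\sum_i `|a i|); split; first exact: num_real.
by move=> y ay x /(hull_le ord0) /le_trans; apply; exact: ltW.
Qed.

(** At the barycentre all four coordinates equal 1/4, and by continuity they stay nonnegative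
    nearby. *)
Lemma hull_interior : exists (c : 'rV[R]_3) (e : R), 0 < e /\ ball c e `<=` hull a predT.
Proof.
pose c : 'rV[R]_3 := \sum_(i < 4) 4^-1 *: a i.
have c0 i : 0 < ev c (baryp i).
  rewrite ev_baryp bary_unique ?invr_gt0 // sumr_const card_ord.
  by rewrite -[LHS]mulr_natr mulVf.
have near_c i : nbhs c [set x | 0 <= ev x (baryp i)].
  apply: (filterS _ (cvgr_gt _ (@ev_continuous _ (baryp i) c) _ (c0 i))).
  by move=> x /ltW.
have /nbhs_ballP[e /= e0 h] : nbhs c [set x | forall i, 0 <= ev x (baryp i)].
  exact: filter_forall near_c.
 exists c, e; split=> // x /h; exact: (hullP x).2.
Qed.

End Simplex.

(** * Weighted integrals of polynomials over a tetrahedron *)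

Section VolumeFunctional.
Set Implicit Arguments.
Unset Strict Implicit.
Unset Printing Implicit Defensive.
Context {R : realType} (a : 'I_4 -> 'rV[R]_3) (w : 'rV[R]_3 -> R).
Implicit Types (p q : mpoly 3 R) (x : 'rV[R]_3).
Hypothesis det_a : \det (\matrix_(i < 3, j < 3) (a (lift ord0 i) - a ord0) 0 j) != 0.
Local Notation simplex := (hull a predT).
Hypothesis w_cont : {within simplex, continuous w}.
Hypothesis w_pos : forall x, simplex x -> 0 < w x.

Local Notation R1 := (measurableTypeR R).
Local Notation mu3 :=
  ((lebesgue_measure \x lebesgue_measure) \x lebesgue_measure)%E.
Local Notation pt := (@pt3 R : R1 * R1 * R1 -> 'rV[R]_3).

Let mA : measurable (pt @^-1` simplex).
Proof. by apply: (measurable_preimage_closed (@measurable_pt3 R)); exact: closed_hull. Qed.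

Let finA : (mu3 (pt @^-1` simplex) < +oo)%E.
Proof.
pose e : R := 1 + \sum_i `|a i|.
have e0 : 0 < e by rewrite ltr_pwDl // sumr_ge0.
apply: (@le_lt_trans _ _ (mu3 (pt @^-1` ball 0 e))).
  apply: le_measure; rewrite ?inE //.
    by apply: (measurable_preimage_open (@measurable_pt3 R)); exact: ball_open.
  move=> u /= /(hull_le ord0) h; rewrite mx_norm_ball /ball_ /= sub0r normrN.
  by apply: le_lt_trans h _; rewrite /e ltrDr.
by rewrite volume_ball // ltry.
Qed.

Let wp_cont p : {within simplex, continuous (fun x => w x * ev x p)}.
Proof.
move=> x; apply: continuousM; first exact: w_cont.
exact: (continuous_subspaceT (@ev_continuous R p)).
Qed.

Lemma vol_integrable p :
  mu3.-integrable (pt @^-1` simplex) (EFin \o ((fun x => w x * ev x p) \o pt)).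
Proof.
apply: (integrable_within (@measurable_pt3 R) (K := simplex)) => //.
exact: compact_hull.
Qed.

(** The weighted integral as a linear functional of formal polynomials; entries of mass matrices are
    sums of its values at products. *)
Definition vol p : R := vol_integral simplex (fun x => w x * ev x p).

Lemma volD p q : vol (p + q) = vol p + vol q.
Proof.
rewrite /vol /vol_integral -RintegralD //; try exact: vol_integrable.
by apply: eq_Rintegral => u _; rewrite /ev mevalD mulrDr.
Qed.

Lemma volZ c p : vol (c *: p) = c * vol p.
Proof.
rewrite /vol /vol_integral -RintegralZl //; try exact: vol_integrable.
by apply: eq_Rintegral => u _; rewrite /ev mevalZ mulrCA.
Qed.

Lemma vol_sqr_ge0 p : 0 <= vol (p * p).
Proof.
apply: Rintegral_ge0 => u Au; rewrite /ev mevalM -expr2.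
by rewrite mulr_ge0 ?sqr_ge0 // ltW // w_pos.
Qed.

(** A nonzero polynomial is nonzero at some point of a ball inside the tetrahedron, and the
    integrand exceeds half its value there on a smaller ball, which has positive volume. *)
Lemma vol_sqr_gt0 p : p != 0 -> 0 < vol (p * p).
Proof.
move=> p0; have [c [e [e0 ce]]] := hull_interior det_a.
have [x [cx px]] : exists x, ball c e x /\ ev x p != 0.
  (* If p vanished on the ball, it would vanish on the beginning of each ray from c, hence on the
     whole line, hence at every v. *)
  apply: contrapT => h; move/eqP: p0; apply; apply: meval_eq0 => v.
  have hball x : ball c e x -> ev x p = 0.
    by move=> cx; apply/eqP/negP => px; apply: h; exists x; split=> //; apply/negP.
  pose dv : 'rV[R]_3 := \row_i (v i - c 0 i).
  have N0 : 0 < 1 + `|dv| by rewrite ltr_pwDl.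
  (* Up to this parameter the point c + t dv stays in the ball; the summand 1 covers the case v =
     c. *)
  have t0 : 0 < e / 2 / (1 + `|dv|) by rewrite !divr_gt0.
  have := @meval_segment_eq0 R 3 (fun i => c 0 i) (fun i => dv 0 i) p _ t0 _ 1.
  move=> <- => [|t /andP[t_ge0 te]].
    by apply: meval_eq => i; rewrite mxE mul1r subrKC.
  have := hball (c + t *: dv); rewrite /ev => <-.
    by apply: meval_eq => i; rewrite !mxE.
  rewrite mx_norm_ball /ball_ /= opprD addNKr normrN normrZ ger0_norm //.
  rewrite ler_pdivlMr // in te; apply: (@le_lt_trans _ _ (e / 2)).
    by apply: le_trans te; apply: ler_wpM2l => //; rewrite lerDr.
  by rewrite ltr_pdivrMr // ltr_pMr // ltr1n.
have [d [d0 [dh df]]] : exists d : R, 0 < d /\ ball x d `<=` simplex /\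
    (forall y, ball x d y -> w x * ev x (p * p) / 2 <= w y * ev y (p * p)).
  pose Bc : set 'rV[R]_3 := ball c e.
  have fc : {in Bc, continuous (fun y => w y * ev y (p * p))}.
    rewrite -continuous_open_subspace; last exact: ball_open.
    exact: (continuous_subspaceW ce (@wp_cont (p * p))).
  have fx0 : 0 < w x * ev x (p * p).
    rewrite mulr_gt0 //; first by apply: w_pos; exact: ce.
    by rewrite /ev mevalM -expr2 exprn_even_gt0.
  have fx2 : w x * ev x (p * p) / 2 < w x * ev x (p * p).
    by rewrite ltr_pdivrMr // ltr_pMr // ltr1n.
  have near_x : nbhs x [set y | w x * ev x (p * p) / 2 <= w y * ev y (p * p)].
    apply: (filterS _ (cvgr_gt _ (fc x _) _ fx2)); last by rewrite inE.
    by move=> y /ltW.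
  have ball_x : nbhs x (ball c e) by apply: open_nbhs_nbhs; split=> //; exact: ball_open.
  have /nbhs_ballP[d /= d0 hd] :
      nbhs x ([set y | w x * ev x (p * p) / 2 <= w y * ev y (p * p)] `&` ball c e).
    exact: filterI.
  exists d; split=> //; split=> y /hd[] // _ /ce //.
rewrite /vol /vol_integral.
apply: (@Rintegral_gt0 _ _ _ mu3 (pt @^-1` simplex) (pt @^-1` ball x d)
  (fun u => w (pt u) * ev (pt u) (p * p)) (w x * ev x (p * p) / 2)).
- exact: mA.
- by apply: (measurable_preimage_open (@measurable_pt3 R)); exact: ball_open.
- by move=> u /dh.
- exact: vol_integrable.
- by move=> u Au; rewrite /ev mevalM -expr2 mulr_ge0 ?sqr_ge0 // ltW // w_pos.
- rewrite divr_gt0 // mulr_gt0 //; first by apply: w_pos; exact: ce.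
  by rewrite /ev mevalM -expr2 exprn_even_gt0.
- by move=> u /df.
- have mub : (0 < mu3 (pt @^-1` ball x d))%E.
    by rewrite volume_ball // lte_fin exprn_gt0 // mulr_gt0.
  exact: mub.
Qed.

End VolumeFunctional.

(** * Polynomials that vanish on a triangle *)

Section TriangleVanishing.
Set Implicit Arguments.
Unset Strict Implicit.
Unset Printing Implicit Defensive.
Context {R : realType} (a e1 e2 : 'rV[R]_3).
Implicit Types (p : mpoly 3 R) (x w : 'rV[R]_3) (s t : R).

Let P s t : 'rV[R]_3 := a + s *: e1 + t *: e2.

(** Each point of the plane lies on a line through the centroid, and a segment of this line starting
    at the centroid lies in the triangle. *)
Lemma ev_plane_eq0 p :
  (forall s t, 0 <= s -> 0 <= t -> s + t <= 1 -> ev (P s t) p = 0) ->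
  forall s t, ev (P s t) p = 0.
Proof.
move=> h s t; pose ds := s - 3^-1; pose dt := t - 3^-1.
(* For r <= 1/N both coordinates move by at most 1/3 in total, which preserves the three
   inequalities of the parameter triangle. *)
pose N := 3 * (1 + `|ds| + `|dt|).
have N0 : 0 < N by rewrite mulr_gt0 // -addrA ltr_pwDl // addr_ge0.
have := @meval_segment_eq0 R 3 (fun i => P 3^-1 3^-1 0 i)
  (fun i => (ds *: e1 + dt *: e2) 0 i) p N^-1 _ _ 1.
rewrite invr_gt0 => /(_ N0) <- => [|r /andP[r0]].
  by apply: meval_eq => i; rewrite !mxE /ds /dt; ring.
rewrite -[_^-1]mul1r ler_pdivlMr // => rN.
rewrite -[RHS](h (3^-1 + r * ds) (3^-1 + r * dt)).
- by apply: meval_eq => i; rewrite !mxE; ring.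
all: have := ler_norm ds; have := ler_norm (- ds); rewrite normrN => ds1 ds2.
all: have := ler_norm dt; have := ler_norm (- dt); rewrite normrN => dt1 dt2.
all: have sx := ler_wpM2l r0 ds1; have sy := ler_wpM2l r0 ds2.
all: have tx := ler_wpM2l r0 dt1; have ty := ler_wpM2l r0 dt2.
all: have rs := mulr_ge0 r0 (normr_ge0 ds); have rt := mulr_ge0 r0 (normr_ge0 dt).
all: move: rN sx sy tx ty rs rt; rewrite /N; lra.
Qed.

Lemma grad_tangent_eq0 p s t : (forall s t, ev (P s t) p = 0) ->
  dotv (\row_i ev (P s t) (mderiv i p)) e1 = 0 /\
  dotv (\row_i ev (P s t) (mderiv i p)) e2 = 0.
Proof.
move=> h; split; rewrite /dotv; under eq_bigr do rewrite mxE mulrC.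
- apply: (@mderiv_eq0_along _ _ (fun i => P s t 0 i) (fun i => e1 0 i)) => r.
  rewrite -[RHS](h (s + r) t); apply: meval_eq => i; rewrite !mxE; ring.
- apply: (@mderiv_eq0_along _ _ (fun i => P s t 0 i) (fun i => e2 0 i)) => r.
  rewrite -[RHS](h s (t + r)); apply: meval_eq => i; rewrite !mxE; ring.
Qed.

(** A vector orthogonal to two independent edges is a multiple of their cross product, hence has no
    tangential part. *)
Lemma tang_eq0 w : enorm (crossv e1 e2) != 0 -> dotv w e1 = 0 -> dotv w e2 = 0 ->
  tang ((enorm (crossv e1 e2))^-1 *: crossv e1 e2) w = 0.
Proof.
move=> n0 w1 w2.
have nn : dotv (crossv e1 e2) (crossv e1 e2) = enorm (crossv e1 e2) ^+ 2.
  by rewrite sqr_sqrtr // sumr_ge0 // => i _; rewrite -expr2 sqr_ge0.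
(* [n x (w x n) = (n.n) w - (n.w) n] and [w x (e1 x e2) = (w.e2) e1 - (w.e1) e2] *)
have key i : dotv (crossv e1 e2) (crossv e1 e2) * w 0 i =
    dotv w (crossv e1 e2) * crossv e1 e2 0 i
    + dotv w e2 * crossv (crossv e1 e2) e1 0 i
    - dotv w e1 * crossv (crossv e1 e2) e2 0 i.
  have c0 x y : crossv x y 0 0 = x 0 1 * y 0 2%:R - x 0 2%:R * y 0 1.
    by rewrite mxE /cross; congr (x 0 _ * y 0 _ - x 0 _ * y 0 _); exact: val_inj.
  have c1 x y : crossv x y 0 1 = x 0 2%:R * y 0 0 - x 0 0 * y 0 2%:R.
    by rewrite mxE /cross; congr (x 0 _ * y 0 _ - x 0 _ * y 0 _); exact: val_inj.
  have c2 x y : crossv x y 0 2%:R = x 0 0 * y 0 1 - x 0 1 * y 0 0.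
    by rewrite mxE /cross; congr (x 0 _ * y 0 _ - x 0 _ * y 0 _); exact: val_inj.
  have dE x y : dotv x y = x 0 0 * y 0 0 + x 0 1 * y 0 1 + x 0 2%:R * y 0 2%:R.
    rewrite /dotv !big_ord_recl big_ord0 addr0 addrA.
    by congr (x 0 _ * y 0 _ + x 0 _ * y 0 _ + x 0 _ * y 0 _); exact: val_inj.
  have hi : [\/ i = 0, i = 1 | i = 2%:R].
    by case: i => [[|[|[|//]]]] hi; [apply: Or31|apply: Or32|apply: Or33]; exact: val_inj.
  by case: hi => ->; rewrite !dE !(c0, c1, c2); ring.
move: key nn n0; set n := crossv e1 e2; move: (enorm n) => r key nn r0.
have dz : dotv w (r^-1 *: n) = r^-1 * dotv w n.
  by rewrite /dotv mulr_sumr; apply: eq_bigr => k _; rewrite mxE mulrCA.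
have {}key i : r ^+ 2 * w 0 i = dotv w n * n 0 i.
  by rewrite -nn key w1 w2 !mul0r addr0 subr0.
clearbody n; apply/rowP => i; rewrite /tang dz !mxE.
apply: (mulfI (expf_neq0 2 r0)); rewrite mulrBr key mulr0.
by field.
Qed.

End TriangleVanishing.

(** * Integrals of polynomials over a face *)

Section FaceFunctional.
Set Implicit Arguments.
Unset Strict Implicit.
Unset Printing Implicit Defensive.
Context {R : realType} {S O : set 'rV[R]_3}.
Context {Th : mesh (exterior_region S O)} (T : 'I_(ntet Th)) (i : 'I_4).
Implicit Types (p q : mpoly 3 R) (x : 'rV[R]_3).

Local Notation R1 := (measurableTypeR R).
Local Notation mu2 := (lebesgue_measure \x lebesgue_measure)%E.
Local Notation a := (fvtx T i ord0).
Local Notation e1 := (edge1 T i).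
Local Notation e2 := (edge2 T i).

Let P (u : R1 * R1) : 'rV[R]_3 := a + (u.1 : R) *: e1 + (u.2 : R) *: e2.

Let A := [set u : R1 * R1 | [/\ 0 <= (u.1 : R), 0 <= (u.2 : R) & (u.1 : R) + u.2 <= 1]].

Let m1 : measurable_fun setT (fun u : R1 * R1 => u.1 : R). Proof. exact: measurable_fst. Qed.
Let m2 : measurable_fun setT (fun u : R1 * R1 => u.2 : R). Proof. exact: measurable_snd. Qed.

Let mA : measurable A.
Proof.
have -> : A = ([set u | 0 <= (u.1 : R)] `&` [set u | 0 <= (u.2 : R)])
    `&` [set u | (u.1 : R) + u.2 <= 1].
  by apply/seteqP; split=> [u [? ? ?]|u [[? ?] ?]].
apply: measurableI; first apply: measurableI; rewrite -[X in measurable X]setTI.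
- by apply: (@measurable_fun_ler _ _ R setT (cst 0) (fun u => u.1) _ _ measurableT [set true]).
- by apply: (@measurable_fun_ler _ _ R setT (cst 0) (fun u => u.2) _ _ measurableT [set true]).
- apply: (@measurable_fun_ler _ _ R setT (fun u => (u.1 : R) + u.2) (cst 1)
    _ _ measurableT [set true]) => //.
  exact: measurable_funD.
Qed.

Let A_le u : A u -> `|u.1 : R| <= 1 /\ `|u.2 : R| <= 1.
Proof. case=> h1 h2 h3; rewrite !ger0_norm //; split; lra. Qed.

Let finA : (mu2 A < +oo)%E.
Proof.
pose B : set R1 := ball (0 : R) 2.
have mb : measurable B by exact: measurable_ball.
apply: (@le_lt_trans _ _ (mu2 (B `*` B))).
  apply: le_measure; rewrite ?inE //; first exact: measurableX.
  move=> u /A_le[u1 u2]; split; rewrite /= /B /ball /= sub0r normrN.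
    by apply: le_lt_trans u1 _; rewrite ltr1n.
  by apply: le_lt_trans u2 _; rewrite ltr1n.
rewrite product_measure1E //.
rewrite (_ : (_ * _)%E = ((2 *+ 2 : R)%:E * (2 *+ 2)%:E)%E).
  by rewrite -EFinM ltry.
by congr (_ * _)%E; exact: lebesgue_measure_ball.
Qed.

Let mP j : measurable_fun setT (fun u => P u 0 j).
Proof.
under eq_fun do rewrite !mxE.
by apply: measurable_funD; [apply: measurable_funD => //|]; apply: measurable_funM.
Qed.

Lemma face_integrable p : mu2.-integrable A (EFin \o ((fun x => ev x p) \o P)).
Proof.
pose C : R := `|a| + `|e1| + `|e2|.
apply: (integrable_within mP (K := [set x | `|x| <= C])) => //.
- move=> u /A_le[u1 u2] /=.
  apply: le_trans (ler_normD _ _) _; apply: lerD.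
    apply: le_trans (ler_normD _ _) _; rewrite lerD2l normrZ.
    by apply: ler_piMl.
  by rewrite normrZ; apply: ler_piMl.
- apply: bounded_closed_compact.
    exists C; split; first exact: num_real.
    by move=> y Cy x /= /le_trans; apply; exact: ltW.
  apply: (@preimage_closed _ _ (fun x : 'rV[R]_3 => `|x|) [set y | y <= C]).
    by move=> x _; exact: norm_continuous.
  exact: closed_le.
- exact: (continuous_subspaceT (@ev_continuous R p)).
Qed.

Definition face_fun p : R := face_integral T i (fun x => ev x p).

Let face_funE p :
  face_fun p = enorm (crossv e1 e2) * \int[mu2]_(u in A) ((fun x => ev x p) \o P) u.
Proof. by []. Qed.

Lemma face_funD p q : face_fun (p + q) = face_fun p + face_fun q.
Proof.
rewrite !face_funE -mulrDr; congr (_ * _).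
rewrite -RintegralD //; try exact: face_integrable.
by apply: eq_Rintegral => u _; rewrite /= /ev mevalD.
Qed.

Lemma face_funZ c p : face_fun (c *: p) = c * face_fun p.
Proof.
rewrite !face_funE mulrCA; congr (_ * _).
rewrite -RintegralZl //; try exact: face_integrable.
by apply: eq_Rintegral => u _; rewrite /= /ev mevalZ.
Qed.

Lemma face_fun_ge0 p : (forall x, 0 <= ev x p) -> 0 <= face_fun p.
Proof. by move=> h; rewrite mulr_ge0 ?sqrtr_ge0 // Rintegral_ge0. Qed.

Lemma face_param s t : 0 <= s -> 0 <= t -> s + t <= 1 ->
  face T i (a + s *: e1 + t *: e2).
Proof.
move=> s0 t0 st.
(* Barycentric weights of the point on the three vertices of the face; the opposite vertex gets
   weight 0. *)
pose c (k : 'I_3) : R := [:: 1 - s - t; s; t]`_k.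
have c0 k : 0 <= c k.
  by case: k => [[|[|[|//]]]] hk; rewrite /c //= -addrA -opprD subr_ge0.
exists (fun j => if unlift i j is Some k then c k else 0); split.
- by move=> j; case: unlift.
- by move=> j /=; rewrite negbK => /eqP ->; rewrite unlift_none.
- rewrite (bigD1_ord i) //= unlift_none add0r.
  under eq_bigr do rewrite liftK.
  by rewrite !big_ord_recl big_ord0 /c /= addr0; ring.
rewrite (bigD1_ord i) //= unlift_none scale0r add0r.
under eq_bigr do rewrite liftK.
rewrite !big_ord_recl big_ord0 addr0 /c /=.
rewrite /edge1 /edge2 -/(fvtx _ _ _).
have -> : lift ord0 ord0 = inord 1 :> 'I_3 by apply: val_inj; rewrite /= inordK.
have -> : lift ord0 (lift ord0 ord0) = inord 2 :> 'I_3 by apply: val_inj; rewrite /= inordK.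
by apply/rowP => k; rewrite !mxE; ring.
Qed.

Lemma face_sub_tet : face T i `<=` tet T.
Proof. by move=> x [w [w0 _ w1 ->]]; exists w. Qed.

(** The area factor annihilates the integral over a degenerate face, so the integrand is examined
    only when the normal is a genuine unit vector. *)
Lemma face_fun_eq0 p :
  (enorm (crossv e1 e2) != 0 -> forall s t, 0 <= s -> 0 <= t -> s + t <= 1 ->
    ev (a + s *: e1 + t *: e2) p = 0) -> face_fun p = 0.
Proof.
move=> h; rewrite /face_fun /face_integral.
have [->|n0] := eqVneq (enorm (crossv e1 e2)) 0; first by rewrite mul0r.
rewrite (@eq_Rintegral _ _ _ _ _ (cst 0)) ?Rintegral_cst ?mul0r ?mulr0 //.
by move=> u; rewrite inE => -[u1 u2 u3]; rewrite /= h.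
Qed.

End FaceFunctional.

(** * Matrices of the finite element spaces *)

Section GramMatrices.
Set Implicit Arguments.
Unset Strict Implicit.
Unset Printing Implicit Defensive.
Context {R : realType} (V : lmodType R) (F : V -> V -> R).
Hypothesis FC : forall u v, F u v = F v u.
Hypothesis FD : forall u v z, F (u + v) z = F u z + F v z.
Hypothesis FZ : forall c u z, F (c *: u) z = c * F u z.
Context (n : nat) (phi : 'I_n -> V).

Definition gram : 'M[R]_n := \matrix_(i, j) F (phi i) (phi j).

Let F_suml m (c : 'I_m -> R) (v : 'I_m -> V) z :
  F (\sum_i c i *: v i) z = \sum_i c i * F (v i) z.
Proof.
have F0 : F 0 z = 0 by rewrite -(scale0r (0 : V)) FZ mul0r.
rewrite (big_morph (F^~ z) (fun u v => FD u v z) F0).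
by apply: eq_bigr => i _; exact: FZ.
Qed.

Lemma ip_gram x : ip gram x x = F (\sum_i x i 0 *: phi i) (\sum_i x i 0 *: phi i).
Proof.
rewrite F_suml ip_dot /dot mxE; apply: eq_bigr => i _.
rewrite FC F_suml !mxE mulrC; congr (_ * _); apply: eq_bigr => j _.
by rewrite mxE mulrC FC.
Qed.

Lemma gram_sym : gram^T = gram.
Proof. by apply/matrixP => i j; rewrite !mxE. Qed.

Lemma gram_psd : (forall v, 0 <= F v v) -> psd gram.
Proof. by move=> h; split=> [|x]; [exact: gram_sym|rewrite ip_gram]. Qed.

Lemma gram_spd : (forall v, v != 0 -> 0 < F v v) ->
  (forall c, \sum_i c i *: phi i = 0 -> forall i, c i = 0) -> spd gram.
Proof.
move=> h free; split=> [|x x0]; first exact: gram_sym.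
rewrite ip_gram h //; apply: contra_neq x0 => /free x0.
by apply/colP => i; rewrite mxE.
Qed.

(** Columns of [B] are coefficient vectors; each of them represents an element orthogonal to
    everything. *)
Lemma gram_mul_eq0 m (B : 'M[R]_(n, m)) :
  (forall u j, F u (\sum_i B i j *: phi i) = 0) -> gram *m B = 0.
Proof.
move=> h; apply/matrixP => i j; have := h (phi i) j; rewrite FC F_suml => hs.
rewrite mxE [RHS]mxE -[RHS]hs.
by apply: eq_bigr => k _; rewrite mxE mulrC FC.
Qed.

End GramMatrices.

Section MatrixOfComposition.
Set Implicit Arguments.
Unset Strict Implicit.
Unset Printing Implicit Defensive.

(** The columns of the product are the coordinates of [L2 (L1 (phi j))], which is zero, in the free
    family [xi]. *)
Lemma matrix_of_comp0 (R : realType) (U V W : lmodType R) (L1 : U -> V) (L2 : V -> W)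
    m n k (phi : 'I_n -> U) (psi : 'I_m -> V) (xi : 'I_k -> W) M N :
  (forall c : 'I_m -> R, L2 (\sum_i c i *: psi i) = \sum_i c i *: L2 (psi i)) ->
  (forall u, L2 (L1 u) = 0) ->
  (forall c : 'I_k -> R, \sum_i c i *: xi i = 0 -> forall i, c i = 0) ->
  matrix_of L1 phi psi M -> matrix_of L2 psi xi N -> N *m M = 0.
Proof.
move=> lin L0 free hM hN; apply/matrixP => i j; rewrite !mxE.
apply: (free (fun i => \sum_l N i l * M l j)).
rewrite -[RHS](L0 (phi j)) hM lin.
under [RHS]eq_bigr do rewrite hN scaler_sumr.
rewrite exchange_big /=; apply: eq_bigr => l _; rewrite scaler_suml.
by apply: eq_bigr => r _; rewrite scalerA mulrC.
Qed.

End MatrixOfComposition.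

Lemma positive_continuous_inv (R : realType) (D : set 'rV[R]_3) w :
  positive_continuous_on D w -> positive_continuous_on D (fun x => (w x)^-1).
Proof.
case=> w_c w_p; split=> [|y Dy]; last by rewrite invr_gt0 w_p.
rewrite continuous_subspace_in => x /set_mem Dx; apply: cvgV; last exact: w_c.
by rewrite gt_eqF // w_p.
Qed.

(** * Complex property, mass matrices and impedance matrix *)

Section FiniteElementMatrices.
Set Implicit Arguments.
Unset Strict Implicit.
Unset Printing Implicit Defensive.
Context {R : realType} {S O : set 'rV[R]_3} (Th : mesh (exterior_region S O)).
Local Notation D := (exterior_region S O).
Local Notation scalars := (pw_scalar Th).
Local Notation vectors := (pw_vector Th).

Lemma curl_grad (p : scalars) : curl (grad p) = 0.
Proof.
by apply/ffunP => T; apply/ffunP => i; rewrite !ffunE mderiv_comm subrr.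
Qed.

Lemma div_curl (v : vectors) : div (curl v) = 0.
Proof.
apply/ffunP => T; rewrite !ffunE !big_ord_recl big_ord0 !ffunE.
have -> : ordS ord0 = lift ord0 ord0 :> 'I_3 by apply: val_inj.
have -> : ordS (lift ord0 ord0) = lift ord0 (lift ord0 ord0) :> 'I_3 by apply: val_inj.
have -> : ordS (lift ord0 (lift ord0 ord0)) = ord0 :> 'I_3 by apply: val_inj.
have -> : ordS ord0 = lift ord0 ord0 :> 'I_3 by apply: val_inj.
rewrite !mderivB.
rewrite (mderiv_comm (lift ord0 ord0) ord0).
rewrite (mderiv_comm (lift ord0 (lift ord0 ord0)) ord0).
rewrite (mderiv_comm (lift ord0 (lift ord0 ord0)) (lift ord0 ord0)).
ring.
Qed.

Lemma curl_sum m (c : 'I_m -> R) (v : 'I_m -> vectors) :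
  curl (\sum_i c i *: v i) = \sum_i c i *: curl (v i).
Proof.
have cD (u1 u2 : vectors) : curl (u1 + u2) = curl u1 + curl u2.
  by apply/ffunP => T; apply/ffunP => i; rewrite !ffunE !mderivD opprD addrACA.
have c0 : curl (0 : vectors) = 0.
  by apply/ffunP => T; apply/ffunP => i; rewrite !ffunE !mderiv0 subrr.
rewrite (big_morph _ cD c0); apply: eq_bigr => i _.
by apply/ffunP => T; apply/ffunP => j; rewrite !ffunE !mderivZ scalerBr.
Qed.

Lemma div_sum m (c : 'I_m -> R) (v : 'I_m -> vectors) :
  div (\sum_i c i *: v i) = \sum_i c i *: div (v i).
Proof.
have cD (u1 u2 : vectors) : div (u1 + u2) = div u1 + div u2.
  apply/ffunP => T; rewrite !ffunE -big_split; apply: eq_bigr => i _.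
  by rewrite !ffunE mderivD.
have c0 : div (0 : vectors) = 0.
  by apply/ffunP => T; rewrite !ffunE big1 // => i _; rewrite !ffunE mderiv0.
rewrite (big_morph _ cD c0); apply: eq_bigr => i _.
apply/ffunP => T; rewrite !ffunE scaler_sumr; apply: eq_bigr => j _.
by rewrite !ffunE mderivZ.
Qed.

Section Mass.
Variables (w : 'rV[R]_3 -> R).
Hypothesis hw : positive_continuous_on (closure D) w.

Let tet_closure (T : 'I_(ntet Th)) : tet T `<=` closure D.
Proof. by move=> x Tx; rewrite (mesh_covers Th); exists T. Qed.

Let wc (T : 'I_(ntet Th)) : {within tet T, continuous w}.
Proof. exact: (continuous_subspaceW (@tet_closure T) hw.1). Qed.

Let wp (T : 'I_(ntet Th)) x : tet T x -> 0 < w x.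
Proof. by move=> /tet_closure; exact: hw.2. Qed.

Let volT (T : 'I_(ntet Th)) p := vol (vtx T) w p.

Let volTD T p q : volT T (p + q) = volT T p + volT T q.
Proof. by apply: volD; [exact: mesh_nondegenerate|exact: wc]. Qed.

Let volTZ T c p : volT T (c *: p) = c * volT T p.
Proof. by apply: volZ; [exact: mesh_nondegenerate|exact: wc]. Qed.

Let volT_ge0 T p : 0 <= volT T (p * p).
Proof. by apply: vol_sqr_ge0; exact: wp. Qed.

Let volT_gt0 T p : p != 0 -> 0 < volT T (p * p).
Proof. by apply: vol_sqr_gt0; [exact: mesh_nondegenerate|exact: wc|exact: wp]. Qed.

(** A nonzero piecewise polynomial is nonzero on some tetrahedron, whose contribution is positive
    while the others are nonnegative. *)
Lemma mass_scalar_spd n (phi : 'I_n -> scalars) H :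
  is_basis H phi -> spd (mass_scalar w phi).
Proof.
case=> free _; pose F (p q : scalars) := \sum_T volT T (p T * q T).
have -> : mass_scalar w phi = gram F phi.
  apply/matrixP => i j; rewrite !mxE; apply: eq_bigr => T _.
  by congr vol_integral; apply/funext => x; rewrite /ev mevalM.
apply: gram_spd free => [p q|p q r|c p q|p p0].
- by apply: eq_bigr => T _; rewrite mulrC.
- by rewrite /F -big_split; apply: eq_bigr => T _; rewrite ffunE mulrDl volTD.
- by rewrite /F mulr_sumr; apply: eq_bigr => T _; rewrite ffunE -scalerAl volTZ.
have [T pT] : exists T, p T != 0.
  apply/existsP; apply: contra_neqT p0; rewrite negb_exists => /forallP h.
  by apply/ffunP => T; rewrite ffunE; apply/eqP; rewrite -[_ == _]negbK.
rewrite /F (bigD1 T) //= ltr_pwDl ?volT_gt0 //.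
by apply: sumr_ge0 => T' _; exact: volT_ge0.
Qed.

Lemma mass_vector_spd n (phi : 'I_n -> vectors) H :
  is_basis H phi -> spd (mass_vector w phi).
Proof.
case=> free _; pose F (u v : vectors) := \sum_T \sum_i volT T (u T i * v T i).
have -> : mass_vector w phi = gram F phi.
  apply/matrixP => i j; rewrite !mxE; apply: eq_bigr => T _.
  have vs : \sum_l volT T (phi i T l * phi j T l) = volT T (\sum_l phi i T l * phi j T l).
    have v0 : volT T 0 = 0 by rewrite -(scale0r (0 : mpoly 3 R)) volTZ mul0r.
    by rewrite (big_morph _ (volTD T) v0).
  rewrite vs; congr vol_integral; apply/funext => x; congr (_ * _).
  by rewrite ev_sum; apply: eq_bigr => l _; rewrite !mxE /ev mevalM.
apply: gram_spd free => [p q|p q r|c p q|p p0].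
- by apply: eq_bigr => T _; apply: eq_bigr => i _; rewrite mulrC.
- rewrite /F -big_split; apply: eq_bigr => T _; rewrite -big_split.
  by apply: eq_bigr => i _; rewrite !ffunE mulrDl volTD.
- rewrite /F mulr_sumr; apply: eq_bigr => T _; rewrite mulr_sumr.
  by apply: eq_bigr => i _; rewrite !ffunE -scalerAl volTZ.
have [T pT] : exists T, p T != 0.
  apply/existsP; apply: contra_neqT p0; rewrite negb_exists => /forallP h.
  by apply/ffunP => T; rewrite ffunE; apply/eqP; rewrite -[_ == _]negbK.
have [i pTi] : exists i, p T i != 0.
  apply/existsP; apply: contra_neqT pT; rewrite negb_exists => /forallP h.
  by apply/ffunP => i; rewrite ffunE; apply/eqP; rewrite -[_ == _]negbK.
rewrite /F (bigD1 T) //= ltr_pwDl //.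
  rewrite (bigD1 i) //= ltr_pwDl ?volT_gt0 //.
  by apply: sumr_ge0 => j _; exact: volT_ge0.
by apply: sumr_ge0 => T' _; apply: sumr_ge0 => j _; exact: volT_ge0.
Qed.

End Mass.

Section Impedance.
Variables (gamma : R).
Hypothesis gamma0 : 0 <= 1 + gamma.

(** The tangential part as a vector of formal polynomials, so that the impedance form becomes a sum
    of values of [face_fun]. *)
Let tpol (nu : 'rV[R]_3) (v : {ffun 'I_3 -> mpoly 3 R}) (i : 'I_3) : mpoly 3 R :=
  v i - (\sum_k nu 0 k *: v k) * mpolyC 3 (nu 0 i).

Let tpolE nu v x : tang nu (vev x v) = \row_i ev x (tpol nu v i).
Proof.
apply/rowP => i; rewrite !mxE /tpol /ev mevalB mevalM mevalC; congr (_ - _ * _).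
rewrite -/(ev x _) ev_sum; apply: eq_bigr => k _.
by rewrite mxE /ev mevalZ mulrC.
Qed.

Let B (u v : vectors) (Fa : 'I_(ntet Th) * 'I_4) : R :=
  face_fun Fa.1 Fa.2 (\sum_i tpol (normal Fa.1 Fa.2) (u Fa.1) i *
                             tpol (normal Fa.1 Fa.2) (v Fa.1) i).

Let F (u v : vectors) : R := (1 + gamma) *
  \sum_(Fa : 'I_(ntet Th) * 'I_4 | `[< face Fa.1 Fa.2 `<=` Gamma_i S O >]) B u v Fa.

Let impedanceE n (phi : 'I_n -> vectors) : impedance gamma phi = gram F phi.
Proof.
apply/matrixP => i j; rewrite !mxE; congr (_ * _); apply: eq_bigr => Fa _.
congr face_integral; apply/funext => x; rewrite !tpolE ev_sum.
by apply: eq_bigr => k _; rewrite !mxE /ev mevalM.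
Qed.

Let FC u v : F u v = F v u.
Proof.
congr (_ * _); apply: eq_bigr => Fa _; congr (face_fun _ _ _).
by apply: eq_bigr => i _; rewrite mulrC.
Qed.

Let tpolD nu u v i : tpol nu (u + v) i = tpol nu u i + tpol nu v i.
Proof.
rewrite /tpol ffunE; under eq_bigr do rewrite ffunE scalerDr.
by rewrite big_split mulrDl opprD addrACA.
Qed.

Let tpolZ nu c u i : tpol nu (c *: u) i = c *: tpol nu u i.
Proof.
rewrite /tpol ffunE scalerBr scalerAl scaler_sumr; congr (_ - _ * _).
by apply: eq_bigr => k _; rewrite ffunE !scalerA mulrC.
Qed.

Let FD u v z : F (u + v) z = F u z + F v z.
Proof.
rewrite /F -mulrDr -big_split /=; congr (_ * _); apply: eq_bigr => Fa _.
rewrite /B -face_funD -big_split /=; congr (face_fun _ _ _).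
by apply: eq_bigr => i _; rewrite ffunE tpolD mulrDl.
Qed.

Let FZ c u z : F (c *: u) z = c * F u z.
Proof.
rewrite /F mulrCA [X in _ = _ * X]mulr_sumr; congr (_ * _); apply: eq_bigr => Fa _.
rewrite /B -face_funZ scaler_sumr; congr (face_fun _ _ _).
by apply: eq_bigr => i _; rewrite ffunE tpolZ scalerAl.
Qed.

Lemma impedance_psd n (phi : 'I_n -> vectors) : psd (impedance gamma phi).
Proof.
rewrite impedanceE; apply: gram_psd => // v.
rewrite mulr_ge0 // sumr_ge0 // => Fa _; apply: face_fun_ge0 => x.
by rewrite ev_sum sumr_ge0 // => i _; rewrite /ev mevalM -expr2 sqr_ge0.
Qed.

Lemma impedance_grad n m k (phiE : 'I_n -> vectors) (phip : 'I_m -> scalars) G :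
  is_basis (lagrange0 k) phip -> matrix_of (@grad R S O Th) phip phiE G ->
  impedance gamma phiE *m G = 0.
Proof.
move=> [_ hphip] hG; rewrite impedanceE; apply: gram_mul_eq0 => // u j.
rewrite -hG; have [_ _ pb] : lagrange0 k (phip j).
  (* Kronecker coefficients show that a basis function belongs to its own space. *)
  rewrite hphip; exists (fun i => (i == j)%:R).
  rewrite (bigD1 j) //= eqxx scale1r big1 ?addr0 // => i /negPf ->.
  by rewrite scale0r.
rewrite /F big1 ?mulr0 // => -[T i] /asboolP /= hF.
apply: face_fun_eq0 => n0 s t s0 t0 st; rewrite ev_sum big1 // => l _.
set x := _ + _ + _.
(* The face lies in the boundary of the domain, where Lagrange functions vanish, and the zero
   extends to the plane of the face. *)
have vanish : forall s t, ev (fvtx T i ord0 + s *: edge1 T i + t *: edge2 T i) (phip j T) = 0.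
  apply: ev_plane_eq0 => s' t' s'0 t'0 st'.
  have hf := face_param T i s'0 t'0 st'.
  by apply: pb; [exact: face_sub_tet hf|have [] := hF _ hf].
have [g1 g2] := @grad_tangent_eq0 _ _ _ _ _ s t vanish.
have := tang_eq0 n0 g1 g2.
have -> : \row_i0 ev x (mderiv i0 (phip j T)) = vev x (grad (phip j) T).
  by apply/rowP => i0; rewrite !mxE !ffunE.
rewrite -/(normal T i) tpolE => /rowP/(_ l); rewrite !mxE => h.
by rewrite /ev mevalM -!/(ev x _) h mulr0.
Qed.

End Impedance.
End FiniteElementMatrices.

(** * Bounds uniform in the mesh, the time step and the coefficients *)

Theorem theorem4p3 (R : realType) (c1E c2E c1p c2p rho : R)
    (hc1E : 0 < c1E) (hc2E : 0 < c2E) (hc1p : 0 < c1p) (hc2p : 0 < c2p)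
    (hrho : rho < Num.sqrt 3 - 1) :
  exists lam Lam : R, [/\ 0 < lam, 0 < Lam &
  forall (S O : set 'rV[R]_3) (hSO : scattering_setting S O)
    (eps mu : 'rV[R]_3 -> R)
    (heps : positive_continuous_on (closure (exterior_region S O)) eps)
    (hmu : positive_continuous_on (closure (exterior_region S O)) mu)
    (gamma : R) (hgamma : 0 <= 1 + gamma)
    (Th : mesh (exterior_region S O)) (k : nat)
    (np nE nB n0 : nat)
    (phip : 'I_np -> pw_scalar Th) (hphip : is_basis (lagrange0 k) phip)
    (phiE : 'I_nE -> pw_vector Th) (hphiE : is_basis (nedelec_imp k) phiE)
    (phiB : 'I_nB -> pw_vector Th) (hphiB : is_basis (rt_imp k) phiB)
    (phi0 : 'I_n0 -> pw_scalar Th) (hphi0 : is_basis (dg k) phi0)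
    (G : 'M[R]_(nE, np)) (hG : matrix_of (@grad R S O Th) phip phiE G)
    (K : 'M[R]_(nB, nE)) (hK : matrix_of (@curl R S O Th) phiE phiB K)
    (D : 'M[R]_(n0, nB)) (hD : matrix_of (@div R S O Th) phiB phi0 D)
    (tau : R) (htau : 0 < tau)
    (QE : 'M[R]_nE) (hQE : spd QE) (Qp : 'M[R]_np) (hQp : spd Qp),
  let Mp := mass_scalar (fun=> 1) phip in
  let ME := mass_vector eps phiE in
  let MB := mass_vector (fun x => (mu x)^-1) phiB in
  let M0 := mass_scalar (fun=> 1) phi0 in
  let Z := impedance gamma phiE in
  let AE := schurE tau MB ME Z K in
  let Ap := schurp tau ME Mp G in
  let A := sysA tau MB ME Mp Z G K in
  let WL := precWL tau MB ME G K QE Qp in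
  let Winv := invmx (precW tau MB M0 D QE Qp) in
  (forall E : 'cV[R]_nE,
     c1E * ip QE E E <= ip (invmx AE) E E <= c2E * ip QE E E) ->
  (forall p : 'cV[R]_np,
     c1p * ip Qp p p <= ip (invmx Ap) p p <= c2p * ip Qp p p) ->
  (opnorm AE (1%:M - QE *m AE) <= rho%:E)%E ->
  forall x : 'cV[R]_(nB + (nE + np)), x != 0 ->
    lam <= ip Winv (WL *m A *m x) x / ip Winv x x /\
    ipnorm Winv (WL *m A *m x) / ipnorm Winv x <= Lam].
Proof.
(* The constants are built from the spectral bounds and rho before the domain, the mesh, the
   coefficients and [tau] are introduced; this order of quantifiers expresses the uniformity. *)
pose C1 := 1 + c1E^-1 + c1p^-1; pose C2 := 1 + c2E + c2p.
pose C3 := (2 + 8 * c2E + 6 / c1p) * C1.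
have C2_gt0 : 0 < C2 by rewrite !addr_gt0.
have C3_gt0 : 0 < C3.
  by rewrite mulr_gt0 // !addr_gt0 ?divr_gt0 ?mulr_gt0 ?invr_gt0.
(* The operator norm hypothesis is unsatisfiable for rho < 0; lam = 1 is then a dummy. *)
pose lam := if 0 <= rho then (3 - (1 + rho) ^+ 2) / (24 * C2) else 1.
exists lam, (Num.sqrt C3); split.
- rewrite /lam; case: ifP => // rho0; rewrite divr_gt0 ?mulr_gt0 // subr_gt0.
  rewrite -[X in _ < X]sqr_sqrtr // ltr_sqr ?nnegrE ?sqrtr_ge0 ?addr_ge0 //.
  by rewrite addrC -ltrBrDr.
- by rewrite sqrtr_gt0.
move=> S O hSO eps mu heps hmu gamma hgamma Th k np nE nB n0 phip hphip phiE hphiE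
  phiB hphiB phi0 hphi0 G hG K hK D hD tau htau QE hQE Qp hQp
  Mp ME MB M0 Z AE Ap A WL Winv hE hp hT x x0.
have one_pos : positive_continuous_on (closure (exterior_region S O)) (fun=> 1 : R).
  by split=> [|y _]; [apply: continuous_subspaceT => y; exact: cst_continuous|exact: ltr01].
have mu_pos :
    positive_continuous_on (closure (exterior_region S O)) (fun y => (mu y)^-1).
  exact: positive_continuous_inv.
have hMp : spd Mp := mass_scalar_spd one_pos hphip.
have hME : spd ME := mass_vector_spd heps hphiE.
have hMB : spd MB := mass_vector_spd mu_pos hphiB.
have hM0 : psd M0 := spd_psd (mass_scalar_spd one_pos hphi0).
have hZ : psd Z := impedance_psd hgamma phiE.
have ZG : Z *m G = 0 := impedance_grad gamma hphip hG.
have KG : K *m G = 0.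
  exact: (matrix_of_comp0 (fun c => curl_sum c phiE) (@curl_grad _ _ _ _) hphiB.1 hG hK).
have DK : D *m K = 0.
  exact: (matrix_of_comp0 (fun c => div_sum c phiB) (@div_curl _ _ _ _) hphi0.1 hK hD).
have rho0 : 0 <= rho by have := le_trans (opnorm_ge0 _ _) hT; rewrite lee_fin.
move: x0; rewrite -[x]vsubmxK -[dsubmx x]vsubmxK.
set B := usubmx x; set E := usubmx (dsubmx x); set p := dsubmx (dsubmx x) => x0.
have Wx := ip_precW_inv_gt0 D htau hMB hM0 hQE hQp x0.
split.
  rewrite ler_pdivlMr // /lam rho0.
  exact: (precWL_coercive htau hMB hME hMp hM0 hZ KG DK ZG hQE hQp
    hc1E hc2E hc1p hc2p hE hp hrho hT).
(* Both norms are square roots, so the claim reduces to the bound on squared norms with constant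
   [C3]. *)
rewrite ler_pdivrMr ?sqrtr_gt0 // /ipnorm -sqrtrM ?(ltW C3_gt0) //.
apply: ler_wsqrtr.
exact: (precWL_bounded htau hMB hME hMp hM0 hZ KG DK ZG hQE hQp
  hc1E hc2E hc1p hc2p hE hp hrho hT).
Qed.
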